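(* Let $M$ be an orientable smooth manifold of dimension $2n+1$. The following assertions are equivalent: (1) $M$ admits an almost contact metric structure; (2) there exists a Riemannian metric $g$ on $M$ such that the gauge equation of self-dual connections with respect to $g$ admits a skew-symmetric solution of rank $2n$; that is, there exist an affine connection $\nabla$ on $M$ with $\nabla=\nabla^*$ (dual taken with respect to $g$) and a $(1,1)$-tensor field $\theta$, skew-symmetric with respect to $g$ and of rank $2n$ at every point, such that $\nabla\theta=0$.
   Context: An almost contact metric structure on $M$ is a quadruple $(\theta,\xi,\eta,g)$ where $\theta$ is a $(1,1)$-tensor field, $\xi$ a vector field, $\eta$ a 1-form and $g$ a Riemannian metric such that $\eta(\xi)=1$, $\theta^2=-\mathrm{Id}+\eta\otimes\xi$ and $g(\theta X,\theta Y)=g(X,Y)-\eta(X)\eta(Y)$ for all vector fields $X,Y$. Given a Riemannian metric $g$ and an affine connection $\nabla$ (torsion allowed), the dual connection $\nabla^*$ is defined by $Z(g(X,Y))=g(\nabla_Z X,Y)+g(X,\nabla^*_Z Y)$. The gauge equation for a $(1,1)$-tensor field $\theta$ is $\nabla^*_X(\theta Y)=\theta(\nabla_X Y)$ for all vector fields $X,Y$; when $\nabla=\nabla^*$ (self-dual connection) it reads $\nabla\theta=0$. Skew-symmetric means $g(\theta X,Y)=-g(X,\theta Y)$. *)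

(* Defs.v *)
From HB Require Import structures.
From mathcomp Require Import all_boot all_order all_algebra.
From mathcomp Require Import all_classical all_reals all_analysis.
Import Order.TTheory GRing.Theory Num.Theory.
Import numFieldNormedType.Exports.

Set Implicit Arguments.
Unset Strict Implicit.
Unset Printing Implicit Defensive.

Local Open Scope classical_set_scope.
Local Open Scope ring_scope.

(* [f] is of class C^k, resp. C^oo, at the points of the set [U], meant to be
   open.  [V] is meant to be finite dimensional: continuity of [df] then
   amounts to continuity of ['D_v f] for every [v]. *)
Fixpoint Cn_on (R : realType) (V W : normedModType R) (k : nat) (U : set V)
    (f : V -> W) : Prop :=
  match k with
  | 0 => forall x, U x -> {for x, continuous f}
  | k'.+1 => (forall x, U x -> differentiable f x) /\
             (forall v : V, Cn_on k' U (fun x => 'D_v f x))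
  end.

Definition smooth_on (R : realType) (V W : normedModType R) (U : set V)
    (f : V -> W) : Prop :=
  forall k, Cn_on k U f.

(* A homeomorphism from the open set [chart_dom] of [T] onto the open set
   [chart_img] of R^N.  Both maps are total; their values outside [chart_dom],
   resp. [chart_img], are irrelevant. *)
Record chart (R : realType) (N : nat) (T : topologicalType) := Chart {
  chart_dom : set T;
  chart_map : T -> 'rV[R]_N;
  chart_inv : 'rV[R]_N -> T;
  chart_dom_open : open chart_dom;
  chart_img_open : open (chart_map @` chart_dom);
  chart_mapK : forall p, chart_dom p -> chart_inv (chart_map p) = p;
  chart_map_cont : forall p, chart_dom p -> {for p, continuous chart_map};
  chart_inv_cont : forall x, (chart_map @` chart_dom) x ->
    {for x, continuous chart_inv} }.

Definition chart_img (R : realType) (N : nat) (T : topologicalType)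
    (c : chart R N T) : set 'rV[R]_N :=
  chart_map c @` chart_dom c.

Definition transition (R : realType) (N : nat) (T : topologicalType)
    (c d : chart R N T) : 'rV[R]_N -> 'rV[R]_N :=
  chart_map d \o chart_inv c.

Definition compatible (R : realType) (N : nat) (T : topologicalType)
    (c d : chart R N T) : Prop :=
  smooth_on (chart_map c @` (chart_dom c `&` chart_dom d)) (transition c d) /\
  smooth_on (chart_map d @` (chart_dom c `&` chart_dom d)) (transition d c).

(* Smooth manifolds without boundary of dimension [N], with a maximal atlas.
   [chart_at p] is an arbitrary choice of a chart around [p], with no
   regularity in [p]. *)
Record manifold (R : realType) (N : nat) := Manifold {
  carrier :> topologicalType;
  carrier_hausdorff : hausdorff_space carrier;
  carrier_second_countable : @second_countable carrier;
  atlas : set (chart R N carrier);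
  atlas_compatible : forall c d, atlas c -> atlas d -> compatible c d;
  atlas_maximal : forall c, (forall d, atlas d -> compatible c d) -> atlas c;
  chart_at : carrier -> chart R N carrier;
  chart_at_atlas : forall p, atlas (chart_at p);
  chart_at_dom : forall p, chart_dom (chart_at p) p }.

Section TensorFields.
Variables (R : realType) (N : nat) (M : manifold R N).

(* A tangent vector at [p] is represented by the row vector of its components
   in the chart [chart_at p], so that T_pM is 'rV[R]_N for every [p].
   Accordingly, a (not necessarily smooth) tensor field is given by its
   components at each [p] in [chart_at p]:
   - a vector field by X : M -> 'rV[R]_N;
   - a 1-form by eta : M -> 'cV[R]_N, with eta_p(v) = v *m eta p;
   - a (1,1)-tensor field by theta : M -> 'M[R]_N, with
     theta_p(v) = v *m theta p;
   - a (0,2)-tensor field by g : M -> 'M[R]_N, with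
     g_p(u, v) = u *m g p *m v^T.
   Since [chart_at p] jumps with [p], smoothness has to be tested on the
   components in fixed charts, obtained with [change]. *)

(* If v is the row of components in [c] of a tangent vector at [p], then
   v *m change c d p is its row of components in [d]. *)
Definition change (c d : chart R N M) (p : M) : 'M[R]_N :=
  jacobian (transition c d) (chart_map c p).

Definition orientable : Prop :=
  exists O : set (chart R N M),
    [/\ O `<=` @atlas R N M,
        forall p : M, exists2 c, O c & chart_dom c p
      & forall c d p, O c -> O d -> chart_dom c p -> chart_dom d p ->
          0 < \det (change c d p)].

Definition smooth_function (f : M -> R) : Prop :=
  forall c, @atlas R N M c -> smooth_on (chart_img c) (f \o chart_inv c).

Definition vector_in (c : chart R N M) (X : M -> 'rV[R]_N) (p : M) : 'rV[R]_N :=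
  X p *m change (chart_at p) c p.

Definition smooth_vector_field (X : M -> 'rV[R]_N) : Prop :=
  forall c, @atlas R N M c ->
    smooth_on (chart_img c) (vector_in c X \o chart_inv c).

Definition form_in (c : chart R N M) (eta : M -> 'cV[R]_N) (p : M) : 'cV[R]_N :=
  change c (chart_at p) p *m eta p.

Definition smooth_one_form (eta : M -> 'cV[R]_N) : Prop :=
  forall c, @atlas R N M c ->
    smooth_on (chart_img c) (form_in c eta \o chart_inv c).

Definition endo_in (c : chart R N M) (theta : M -> 'M[R]_N) (p : M) : 'M[R]_N :=
  change c (chart_at p) p *m theta p *m change (chart_at p) c p.

Definition smooth_endo (theta : M -> 'M[R]_N) : Prop :=
  forall c, @atlas R N M c ->
    smooth_on (chart_img c) (endo_in c theta \o chart_inv c).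

Definition bilin_in (c : chart R N M) (g : M -> 'M[R]_N) (p : M) : 'M[R]_N :=
  change c (chart_at p) p *m g p *m (change c (chart_at p) p)^T.

Definition smooth_bilin (g : M -> 'M[R]_N) : Prop :=
  forall c, @atlas R N M c ->
    smooth_on (chart_img c) (bilin_in c g \o chart_inv c).

Definition one_form_app (eta : M -> 'cV[R]_N) (p : M) (v : 'rV[R]_N) : R :=
  (v *m eta p) 0 0.

Definition endo_app (theta : M -> 'M[R]_N) (p : M) (v : 'rV[R]_N) : 'rV[R]_N :=
  v *m theta p.

Definition bilin_app (g : M -> 'M[R]_N) (p : M) (u v : 'rV[R]_N) : R :=
  (u *m g p *m v^T) 0 0.

Definition endo_field (theta : M -> 'M[R]_N) (X : M -> 'rV[R]_N) :
    M -> 'rV[R]_N :=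
  fun p => endo_app theta p (X p).

Definition bilin_fields (g : M -> 'M[R]_N) (X Y : M -> 'rV[R]_N) : M -> R :=
  fun p => bilin_app g p (X p) (Y p).

Definition riemannian_metric (g : M -> 'M[R]_N) : Prop :=
  [/\ smooth_bilin g,
      forall (p : M) (u v : 'rV[R]_N), bilin_app g p u v = bilin_app g p v u
    & forall (p : M) (v : 'rV[R]_N), v != 0 -> 0 < bilin_app g p v v].

Definition almost_contact_metric (theta : M -> 'M[R]_N) (xi : M -> 'rV[R]_N)
    (eta : M -> 'cV[R]_N) (g : M -> 'M[R]_N) : Prop :=
  [/\ [/\ smooth_endo theta, smooth_vector_field xi, smooth_one_form eta
        & riemannian_metric g],
      forall p : M, one_form_app eta p (xi p) = 1,
      forall (p : M) (v : 'rV[R]_N),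
        endo_app theta p (endo_app theta p v)
          = - v + one_form_app eta p v *: xi p
    & forall (p : M) (u v : 'rV[R]_N),
        bilin_app g p (endo_app theta p u) (endo_app theta p v)
          = bilin_app g p u v - one_form_app eta p u * one_form_app eta p v].

(* The derivative X(f) of the function [f] along [X]. *)
Definition lie_function (X : M -> 'rV[R]_N) (f : M -> R) : M -> R :=
  fun p => 'D_(X p) (f \o chart_inv (chart_at p)) (chart_map (chart_at p) p).

(* [nabla X Y] is the covariant derivative of [Y] along [X].  Only the values
   of [nabla] on smooth vector fields are relevant. *)
Record affine_connection
    (nabla : (M -> 'rV[R]_N) -> (M -> 'rV[R]_N) -> (M -> 'rV[R]_N)) : Prop := {
  conn_smooth : forall X Y, smooth_vector_field X -> smooth_vector_field Y ->
    smooth_vector_field (nabla X Y);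
  conn_addl : forall X X' Y, smooth_vector_field X -> smooth_vector_field X' ->
    smooth_vector_field Y ->
    nabla (fun p => X p + X' p) Y = (fun p => nabla X Y p + nabla X' Y p);
  conn_scalel : forall f X Y, smooth_function f -> smooth_vector_field X ->
    smooth_vector_field Y ->
    nabla (fun p => f p *: X p) Y = (fun p => f p *: nabla X Y p);
  conn_addr : forall X Y Y', smooth_vector_field X -> smooth_vector_field Y ->
    smooth_vector_field Y' ->
    nabla X (fun p => Y p + Y' p) = (fun p => nabla X Y p + nabla X Y' p);
  conn_leibniz : forall f X Y, smooth_function f -> smooth_vector_field X ->
    smooth_vector_field Y ->
    nabla X (fun p => f p *: Y p)
      = (fun p => lie_function X f p *: Y p + f p *: nabla X Y p) }.

(* [nabla_star] is the dual of [nabla] with respect to [g]. *)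
Definition dual_connection (g : M -> 'M[R]_N)
    (nabla nabla_star :
       (M -> 'rV[R]_N) -> (M -> 'rV[R]_N) -> (M -> 'rV[R]_N)) : Prop :=
  forall X Y Z, smooth_vector_field X -> smooth_vector_field Y ->
    smooth_vector_field Z ->
    lie_function Z (bilin_fields g X Y)
      = (fun p => bilin_fields g (nabla Z X) Y p
                  + bilin_fields g X (nabla_star Z Y) p).

Definition self_dual (g : M -> 'M[R]_N)
    (nabla : (M -> 'rV[R]_N) -> (M -> 'rV[R]_N) -> (M -> 'rV[R]_N)) : Prop :=
  dual_connection g nabla nabla.

Definition gauge_equation
    (nabla nabla_star :
       (M -> 'rV[R]_N) -> (M -> 'rV[R]_N) -> (M -> 'rV[R]_N))
    (theta : M -> 'M[R]_N) : Prop :=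
  forall X Y, smooth_vector_field X -> smooth_vector_field Y ->
    nabla_star X (endo_field theta Y) = endo_field theta (nabla X Y).

(* The value on X, Y of the covariant derivative of [theta]. *)
Definition cov_deriv_endo
    (nabla : (M -> 'rV[R]_N) -> (M -> 'rV[R]_N) -> (M -> 'rV[R]_N))
    (theta : M -> 'M[R]_N) (X Y : M -> 'rV[R]_N) : M -> 'rV[R]_N :=
  fun p => nabla X (endo_field theta Y) p - endo_field theta (nabla X Y) p.

Definition parallel_endo
    (nabla : (M -> 'rV[R]_N) -> (M -> 'rV[R]_N) -> (M -> 'rV[R]_N))
    (theta : M -> 'M[R]_N) : Prop :=
  forall X Y, smooth_vector_field X -> smooth_vector_field Y ->
    cov_deriv_endo nabla theta X Y = (fun=> 0).

Lemma gauge_equation_parallel nabla theta :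
  gauge_equation nabla nabla theta <-> parallel_endo nabla theta.
Proof.
split=> h X Y sX sY; apply/funext => p.
  by rewrite /cov_deriv_endo (h X Y sX sY) subrr.
by apply/eqP; rewrite -subr_eq0; apply/eqP; exact: (congr1 (@^~ p) (h X Y sX sY)).
Qed.

Definition skew_symmetric (g theta : M -> 'M[R]_N) : Prop :=
  forall (p : M) (u v : 'rV[R]_N),
    bilin_app g p (endo_app theta p u) v
      = - bilin_app g p u (endo_app theta p v).

Definition constant_rank (theta : M -> 'M[R]_N) (r : nat) : Prop :=
  forall p : M, \rank (theta p) = r.

End TensorFields.

Arguments orientable {R N} M.

(* Main.v *)
Require Import Defs.
From mathcomp Require Import all_boot all_order all_algebra.
From mathcomp Require Import all_classical all_reals all_analysis.
From mathcomp Require Import complex ring lra.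
Import Order.TTheory GRing.Theory Num.Theory.
Import numFieldNormedType.Exports.

Set Implicit Arguments.
Unset Strict Implicit.
Unset Printing Implicit Defensive.

Local Open Scope classical_set_scope.
Local Open Scope ring_scope.

(* Given a skew-symmetric theta of rank 2n, let x be a unit vector spanning
   ker theta at a point and P the orthogonal projection on it. The polar part phi = (P - theta^2)^(-1/2) theta
   satisfies phi^2 = - 1 + P and is an isometry of the orthogonal of x. The sign of
   x is fixed by the orientation of the manifold, since the orthogonal of x is
   oriented by the complex structure phi. Smoothness is local: ker theta has smooth
   local sections, and the square root of a smooth positive definite matrix is
   smooth.

   Conversely, let D be the Levi-Civita connection of g. With P = 1 + theta^2 and
   h = - theta^2 the connection
     P D_X (P Y) + (h D_X (h Y) - theta D_X (theta Y)) / 2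
   is metric and makes theta parallel. *)

(** * Calculus of maps of class C^k *)

(** Components at p refer to [chart_at p], which jumps with p. Every pointwise construction (root,
    polar part, positivity, covariant derivative) is therefore shown to be equivariant under changes
    of basis, and its smoothness is then read in a fixed chart. Matrices act on rows from the right,
    so that skewness reads theta g = - g theta^T.

    The form of - theta^2 is only semidefinite, with kernel spanned by x; adding P makes it
    definite. As P does not see the sign of x, phi is available before that sign and can serve to
    choose it.

    Roots are obtained point by point from the spectral theorem, which says nothing about their
    dependence on the point. The equation S X + X T = C, uniquely solvable for positive S and T,
    supplies what is missing: uniqueness, commutation with theta and differentiability.

    In the converse P and h are complementary orthogonal projections and theta is a complex
    structure on the image of h. D is compressed to the kernel, and on the image it is averaged with
    its conjugate by theta. Once expanded, D_X (theta^2 Y) followed by theta^2 has coefficient 3/2: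
    1 from P D_X (P Y) and 1/2 from h D_X (h Y). *)

Section Diff.
Context {R : realType} {V : normedModType R}.

Lemma differentiable_small (W : normedModType R) (f : V -> W) (x : V) :
  (forall e : R, 0 < e -> \forall y \near x, `|f y - f x| <= e * `|y - x|) ->
  differentiable f x.
Proof.
move=> h.
have H : f \o shift x = cst (f x) + \0 +o_ 0 id.
  apply/eqaddoP => e e0; move: (h e e0).
  rewrite (near_shift 0 x) => {}h.
  apply: filterS h => y.
  by rewrite /= fctE /= subr0 addr0 addrK.
have c0 : continuous (\0 : V -> W) by move=> y; exact: cvg_cst.
apply/diff_locallyP.
have -> : 'd f x = \0 :> (V -> W).
  exact: (@diff_unique _ _ _ _ (\0 : {linear V -> W}) _ c0 H).
by split.
Qed.

Lemma differentiable_bound (W : normedModType R) (f : V -> W) (x : V) :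
  differentiable f x ->
  exists2 k : R, 0 < k & \forall y \near x, `|f y - f x| <= k * `|y - x|.
Proof.
move=> df; have [k k0 hk] := linear_lipschitz (diff_continuous df).
exists (k + 1); first by rewrite addr_gt0.
have /diff_locally/eqaddoP/(_ _ ltr01) := df.
rewrite -nbhs_nearE => h; rewrite (near_shift 0 x).
apply: filterS h => y; rewrite /= !fctE /= subr0 addrK mul1r opprD addrA => h.
have -> : f (y + x) - f x = (f (y + x) - f x - 'd f x y) + 'd f x y.
  by rewrite subrK.
by rewrite (le_trans (ler_normD _ _))// mulrDl mul1r addrC lerD.
Qed.

(** [g] is [f] plus a map that vanishes near [x], to which [differentiable_small] applies. *)
Lemma near_eq_differentiable (W : normedModType R) (f g : V -> W) (x : V) :
  (\near x, f x = g x) -> differentiable f x -> differentiable g x.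
Proof.
move=> fg df.
have -> : g = f + (g - f) by rewrite addrC subrK.
apply: differentiableD => //; apply: differentiable_small => e e0.
near=> y.
rewrite !fctE (_ : f y = g y); last by near: y.
by rewrite (nbhs_singleton fg) !subrr normr0 mulr_ge0// ltW.
Unshelve. all: by end_near.
Qed.

Lemma differentiable_mxP m n (f : V -> 'M[R]_(m, n)) x :
  differentiable f x <-> forall i j, differentiable (fun y => f y i j : R) x.
Proof.
split=> [df i j|df].
  exact: (differentiable_comp df (differentiable_coord _ i j)).
have -> : f = \sum_(i < m) \sum_(j < n) (fun y => f y i j *: delta_mx i j).
  apply/funext => y; rewrite fct_sumE [LHS]matrix_sum_delta.
  by apply: eq_bigr => i _; rewrite fct_sumE.
apply: differentiable_sum => i; apply: differentiable_sum => j.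
exact: differentiableZl.
Qed.

(* Caratheodory's criterion: [q * h] is differentiable although [q] is only
   continuous. *)
Lemma differentiable_continuous_mul0 (q h : V -> R) x :
  {for x, continuous q} -> differentiable h x -> h x = 0 ->
  differentiable (q * h) x.
Proof.
move=> qc dh hx.
(* The second term is o(|y - x|): [q - q x] tends to 0, and [h], differentiable and zero at [x], is
   O(|y - x|). *)
have -> : q * h = cst (q x) * h + (q - cst (q x)) * h.
  by apply/funext => y; rewrite !fctE /= -mulrDl addrCA subrr addr0.
apply: differentiableD; first by apply: differentiableM.
apply: differentiable_small => e e0.
have [k k0 hk] := differentiable_bound dh.
have ek : 0 < e / k by rewrite divr_gt0.
move/cvgrPdist_lt : qc => /(_ _ ek) qc.
near=> y; rewrite !fctE hx mulr0 subr0 normrM.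
have h1 : `|q x - q y| < e / k by near: y.
have h2 : `|h y - h x| <= k * `|y - x| by near: y.
rewrite distrC in h1; rewrite hx subr0 in h2.
rewrite (le_trans (ler_pM _ _ (ltW h1) h2))//.
by rewrite mulrA divfK// gt_eqF.
Unshelve. all: by end_near.
Qed.

End Diff.

Section Cn.
Context {R : realType} {V : normedModType R}.
Implicit Types (U : set V).

(** Every clause of [Cn_on] is a condition at single points, so that smoothness may be proved on a
    neighbourhood that varies with the point; the kernel field needs this. *)
Lemma Cn_on_local (W : normedModType R) k U (f : V -> W) :
  (forall x, U x -> exists2 U', U' x & Cn_on k U' f) -> Cn_on k U f.
Proof.
elim: k f => [|k IH] f h /=.
  by move=> x /h[U' Ux c]; exact: c.
split=> [x /h[U' Ux [c _]]|v]; first exact: c.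
by apply: IH => x /h[U' Ux [_ c]]; exists U' => //; exact: c.
Qed.

Lemma Cn_on_sub (W : normedModType R) k U U' (f : V -> W) :
  U' `<=` U -> Cn_on k U f -> Cn_on k U' f.
Proof. by move=> UU' h; apply: Cn_on_local => x /UU'; exists U. Qed.

Lemma Cn_on_eq (W : normedModType R) k U (f g : V -> W) :
  open U -> {in U, f =1 g} -> Cn_on k U f -> Cn_on k U g.
Proof.
move=> oU; elim: k f g => [|k IH] f g fg /=.
  move=> c x Ux; have fgx : \near x, f x = g x.
    near=> y; apply: fg; rewrite inE; near: y.
    exact: open_nbhs_nbhs.
  suff : g @ x --> f x by rewrite (nbhs_singleton fgx).
  by apply: cvg_trans (c x Ux); exact: near_eq_cvg.
have fgx x : U x -> \near x, f x = g x.
  move=> Ux; near=> y; apply: fg; rewrite inE; near: y.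
  exact: open_nbhs_nbhs.
move=> [df c]; split=> [x Ux|v].
  by apply: (near_eq_differentiable (fgx _ Ux)); exact: df.
apply: IH (c v) => x; rewrite inE => Ux.
exact/near_eq_derive/fgx.
Unshelve. all: by end_near.
Qed.

Lemma Cn_onW (W : normedModType R) k U (f : V -> W) :
  Cn_on k.+1 U f -> Cn_on k U f.
Proof.
elim: k f => [|k IH] f [df c].
  by move=> x Ux; exact/differentiable_continuous/df.
by split=> // v; apply: IH; exact: c.
Qed.

Lemma Cn_on_cst (W : normedModType R) k U (a : W) : Cn_on k U (cst a).
Proof.
elim: k a => [|k IH] a /=; first by move=> x _; exact: cvg_cst.
split=> // v.
rewrite (_ : (fun x => _) = cst 0); first exact: IH.
by apply/funext => x; rewrite derive_cst.
Qed.

Lemma Cn_onD (W : normedModType R) k U (f g : V -> W) : open U ->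
  Cn_on k U f -> Cn_on k U g -> Cn_on k U (f + g).
Proof.
move=> oU; elim: k f g => [|k IH] f g /=.
  by move=> cf cg x Ux; apply: continuousD; [exact: cf|exact: cg].
move=> [df cf] [dg cg]; split=> [x Ux|v].
  by apply: differentiableD; [exact: df|exact: dg].
apply: (@Cn_on_eq _ _ _ (fun x => 'D_v f x + 'D_v g x)) => //.
  move=> x; rewrite inE => Ux.
  by rewrite deriveD//; apply: diff_derivable; [exact: df|exact: dg].
exact: (IH _ _ (cf v) (cg v)).
Qed.

Lemma Cn_onM k U (f g : V -> R) : open U ->
  Cn_on k U f -> Cn_on k U g -> Cn_on k U (fun x => f x * g x).
Proof.
move=> oU; elim: k f g => [|k IH] f g.
  by move=> cf cg x Ux; apply: continuousM; [exact: cf|exact: cg].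
move=> Cf Cg; have [[df cf] [dg cg]] := (Cf, Cg); split=> [x Ux|v].
  by apply: differentiableM; [exact: df|exact: dg].
apply: (@Cn_on_eq _ _ _ ((fun x => f x * 'D_v g x) + (fun x => g x * 'D_v f x))) => //.
  move=> x; rewrite inE => Ux.
  by rewrite deriveM//; apply: diff_derivable; [exact: df|exact: dg].
apply: Cn_onD => //; apply: IH => //; solve[exact: Cn_onW|exact: cf|exact: cg].
Qed.

Lemma Cn_on_sum (W : normedModType R) k U (I : Type) (r : seq I) (P : pred I)
    (f : I -> V -> W) : open U ->
  (forall i, P i -> Cn_on k U (f i)) ->
  Cn_on k U (fun x => \sum_(i <- r | P i) f i x).
Proof.
move=> oU h; rewrite (_ : (fun x => _) = \sum_(i <- r | P i) f i); last first.
  by apply/funext => x; rewrite fct_sumE.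
by apply: big_ind => // [|? ? ? ?]; [exact: Cn_on_cst|exact: Cn_onD].
Qed.

Lemma Cn_on_prod k U (I : Type) (r : seq I) (P : pred I) (f : I -> V -> R) :
  open U -> (forall i, P i -> Cn_on k U (f i)) ->
  Cn_on k U (fun x => \prod_(i <- r | P i) f i x).
Proof.
move=> oU h; elim: r => [|i r IH].
  by under eq_fun do rewrite big_nil; exact: Cn_on_cst.
under eq_fun do rewrite big_cons.
have [Pi|//] := boolP (P i).
by apply: Cn_onM => //; exact: h.
Qed.

Lemma Cn_onV k U (f : V -> R) : open U ->
  {in U, forall x, f x != 0} -> Cn_on k U f -> Cn_on k U (fun x => (f x)^-1).
Proof.
move=> oU f0; elim: k => [|k IH].
  move=> c x Ux; apply: cvgV; last exact: c.
  by apply: f0; rewrite inE.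
move=> C; have [df cf] := C; split=> [x Ux|v].
  by apply: differentiableV; [exact: df|apply: f0; rewrite inE].
apply: (@Cn_on_eq _ _ _ (fun x => - 1 * ((f x)^-1 * (f x)^-1) * 'D_v f x)) => //.
  move=> x Ux; rewrite deriveV; last 2 first.
  - exact: f0.
  - by apply: diff_derivable; apply: df; rewrite inE in Ux.
  by rewrite mulN1r expr2 invfM.
have CV := IH (Cn_onW C).
apply: Cn_onM => //; last exact: cf.
apply: Cn_onM => //; first exact: (Cn_on_cst _ _ (-1 : R)).
exact: Cn_onM.
Qed.

Lemma Cn_on_mxP k U m n (f : V -> 'M[R]_(m, n)) : open U ->
  Cn_on k U f <-> forall i j, Cn_on k U (fun x => f x i j : R).
Proof.
move=> oU; elim: k f => [|k IH] f /=.
  split=> [h i j x Ux|h x Ux].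
    exact: (continuous_comp (h _ Ux) (@coord_continuous _ _ _ _ _ _)).
  apply/cvgrPdist_le => e e0; near=> y.
  rewrite /Num.Def.normr/= mx_normrE (bigmax_le _ (ltW e0))//= => i _.
  rewrite !mxE/=; move: i; near: y; apply: filter_forall => /= i.
  exact: ((cvgrPdist_le _ _).1 (h i.1 i.2 x Ux)).
have E v i j : (forall x, U x -> differentiable f x) ->
    {in U, (fun x => ('D_v f x) i j) =1 'D_v (fun x => f x i j : R)}.
  move=> df x; rewrite inE => Ux.
  by rewrite derive_mx ?mxE//; exact/diff_derivable/df.
split=> [[df c] i j|h].
  split=> [x Ux|v]; first by move/df/differentiable_mxP : Ux.
  by apply: (Cn_on_eq oU (E v i j df)); move/IH : (c v); exact.
have df x : U x -> differentiable f x.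
  by move=> Ux; apply/differentiable_mxP => i j; exact: (h i j).1.
split=> [//|v]; apply/IH => i j; have [_ /(_ v)] := h i j.
by apply: Cn_on_eq => // x Ux; rewrite E.
Unshelve. all: by end_near.
Qed.

Lemma Cn_on_entry k U m n (f : V -> 'M[R]_(m, n)) i j : open U ->
  Cn_on k U f -> Cn_on k U (fun x => f x i j : R).
Proof. by move=> oU /(Cn_on_mxP _ _ oU). Qed.

End Cn.

(** * Matrix-valued maps of class C^k *)

Section CnMatrix.
Context {R : realType} {V : normedModType R}.
Implicit Types (U : set V).

Lemma differentiable_mulmx m n p (f : V -> 'M[R]_(m, n)) (g : V -> 'M[R]_(n, p))
    x : differentiable f x -> differentiable g x ->
  differentiable (fun y => f y *m g y) x.
Proof.
move=> /differentiable_mxP df /differentiable_mxP dg.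
apply/differentiable_mxP => i j.
rewrite (_ : (fun y => _) =
    \sum_k ((fun y => f y i k : R) * (fun y => g y k j : R))); last first.
  by apply/funext => y; rewrite mxE fct_sumE.
by apply: differentiable_sum => k; apply: differentiableM.
Qed.

Lemma derive_mulmx m n p (f : V -> 'M[R]_(m, n)) (g : V -> 'M[R]_(n, p)) x v :
  differentiable f x -> differentiable g x ->
  'D_v (fun y => f y *m g y) x = 'D_v f x *m g x + f x *m 'D_v g x.
Proof.
move=> df dg.
rewrite derive_mx; last exact/diff_derivable/differentiable_mulmx.
rewrite (derive_mx (diff_derivable df)) (derive_mx (diff_derivable dg)).
move/differentiable_mxP : df => df; move/differentiable_mxP : dg => dg.
apply/matrixP => i j; rewrite !mxE.
rewrite (_ : (fun y => _) =
    \sum_k ((fun y => f y i k : R) * (fun y => g y k j : R))); last first.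
  by apply/funext => y; rewrite mxE fct_sumE.
rewrite derive_sum; last first.
  by move=> k; apply: derivableM; apply: diff_derivable.
rewrite -big_split/=; apply: eq_bigr => k _.
rewrite deriveM; [|exact: diff_derivable..].
rewrite !mxE addrC; congr (_ + _); exact: mulrC.
Qed.

Lemma differentiable_trmx m n (f : V -> 'M[R]_(m, n)) x :
  differentiable f x -> differentiable (fun y => (f y)^T) x.
Proof.
move=> /differentiable_mxP df; apply/differentiable_mxP => i j.
rewrite (_ : (fun y => _) = (fun y => f y j i)) //.
by apply/funext => y; rewrite mxE.
Qed.

Lemma derive_trmx m n (f : V -> 'M[R]_(m, n)) x v : differentiable f x ->
  'D_v (fun y => (f y)^T) x = ('D_v f x)^T.
Proof.
move=> df; rewrite derive_mx; last exact/diff_derivable/differentiable_trmx.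
rewrite (derive_mx (diff_derivable df)); apply/matrixP => i j; rewrite !mxE.
by congr ('D_v _ x); apply/funext => y; rewrite mxE.
Qed.

Section entries.
Variables (k : nat) (U : set V).
Hypothesis oU : open U.

Lemma Cn_on_mx m n (f : 'I_m -> 'I_n -> V -> R) :
  (forall i j, Cn_on k U (f i j)) -> Cn_on k U (fun x => \matrix_(i, j) f i j x).
Proof.
by move=> h; apply/Cn_on_mxP => // i j; under eq_fun do rewrite mxE; exact: h.
Qed.

Lemma Cn_on_mulmx m n p (f : V -> 'M[R]_(m, n)) (g : V -> 'M[R]_(n, p)) :
  Cn_on k U f -> Cn_on k U g -> Cn_on k U (fun x => f x *m g x).
Proof.
move=> /(Cn_on_mxP _ _ oU) cf /(Cn_on_mxP _ _ oU) cg.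
apply/Cn_on_mxP => // i j; under eq_fun do rewrite mxE.
by apply: Cn_on_sum => // l _; apply: Cn_onM.
Qed.

Lemma Cn_on_trmx m n (f : V -> 'M[R]_(m, n)) :
  Cn_on k U f -> Cn_on k U (fun x => (f x)^T).
Proof.
move=> /(Cn_on_mxP _ _ oU) cf; apply/Cn_on_mxP => // i j.
by under eq_fun do rewrite mxE.
Qed.

Lemma Cn_on_mxZ m n (a : V -> R) (f : V -> 'M[R]_(m, n)) :
  Cn_on k U a -> Cn_on k U f -> Cn_on k U (fun x => a x *: f x).
Proof.
move=> ca /(Cn_on_mxP _ _ oU) cf; apply/Cn_on_mxP => // i j.
by under eq_fun do rewrite mxE; exact: Cn_onM.
Qed.

Lemma Cn_on_mxN m n (f : V -> 'M[R]_(m, n)) :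
  Cn_on k U f -> Cn_on k U (fun x => - f x).
Proof.
move=> cf; under eq_fun do rewrite -scaleN1r.
by apply: Cn_on_mxZ => //; exact: Cn_on_cst.
Qed.

Lemma Cn_on_mxB m n (f g : V -> 'M[R]_(m, n)) :
  Cn_on k U f -> Cn_on k U g -> Cn_on k U (fun x => f x - g x).
Proof. by move=> cf cg; apply: (Cn_onD oU cf); exact: Cn_on_mxN. Qed.

Lemma Cn_on_det n (f : V -> 'M[R]_n) :
  Cn_on k U f -> Cn_on k U (fun x => \det (f x)).
Proof.
move=> /(Cn_on_mxP _ _ oU) cf; apply: Cn_on_sum => // s _.
by apply: Cn_onM => //; [exact: Cn_on_cst|exact: Cn_on_prod].
Qed.

(** By Cramer's formula the inverse is polynomial in the entries up to division by the
    determinant. *)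
Lemma Cn_on_invmx n (f : V -> 'M[R]_n) :
  {in U, forall x, f x \in unitmx} ->
  Cn_on k U f -> Cn_on k U (fun x => invmx (f x)).
Proof.
move=> fu cf.
apply: (@Cn_on_eq _ _ _ _ _
  (fun x => (\det (f x))^-1 *: \adj (f x))) => //.
  by move=> x /fu fx; rewrite /invmx fx.
apply: Cn_on_mxZ.
  apply: Cn_onV => //; last exact: Cn_on_det.
  by move=> x /fu; rewrite unitmxE unitfE.
apply/Cn_on_mxP => // i j; under eq_fun do rewrite mxE.
apply: Cn_onM => //; first exact: Cn_on_cst.
apply: Cn_on_det; apply/Cn_on_mxP => // a b.
under eq_fun do rewrite !mxE.
by move/(Cn_on_mxP _ _ oU) : cf.
Qed.

End entries.

End CnMatrix.

(** * Square roots of positive definite matrices *)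

Section PosDef.
Context {R : realType}.

Definition posdef n (A : 'M[R]_n) : Prop :=
  A^T = A /\ forall v : 'rV_n, v != 0 -> 0 < (v *m A *m v^T) 0 0.

Lemma posdef1 n : posdef (1%:M : 'M[R]_n).
Proof.
split=> [|v v0]; first exact: trmx1.
rewrite mulmx1 mxE lt_neqAle; apply/andP; split.
  apply: contra v0; rewrite eq_sym psumr_eq0; last first.
    by move=> i _; rewrite mxE -expr2 sqr_ge0.
  move=> /allP h; apply/eqP/rowP => i; rewrite [RHS]mxE; apply/eqP.
  by have := h i (mem_index_enum _); rewrite mxE /= mulf_eq0 orbb.
by apply: sumr_ge0 => i _; rewrite mxE -expr2 sqr_ge0.
Qed.

Lemma posdef_unit n (A : 'M[R]_n) : posdef A -> A \in unitmx.
Proof.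
move=> [_ hA]; rewrite -row_free_unit -kermx_eq0.
apply/negPn/negP => /rowV0Pn[v /sub_kermxP vA v0].
by have := hA v v0; rewrite vA mul0mx mxE ltxx.
Qed.

Lemma posdef_congr n (A P : 'M[R]_n) :
  P \in unitmx -> posdef A -> posdef (P *m A *m P^T).
Proof.
move=> Pu [sA hA]; split; first by rewrite !trmx_mul trmxK sA mulmxA.
move=> v v0; have := hA (v *m P); rewrite trmx_mul !mulmxA; apply.
by apply: contra v0 => /eqP/(congr1 (mulmx^~ (invmx P))); rewrite mulmxK// mul0mx => ->.
Qed.

Lemma posdef_ge0 n (A : 'M[R]_n) (v : 'rV_n) : posdef A ->
  0 <= (v *m A *m v^T) 0 0.
Proof.
move=> [_ h]; have [->|/h/ltW//] := eqVneq v 0.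
by rewrite !mul0mx mxE.
Qed.

Lemma mxtrace_rows m n (A : 'M[R]_n) (X : 'M[R]_(m, n)) :
  \tr (X *m A *m X^T) = \sum_i (row i X *m A *m (row i X)^T) 0 0.
Proof.
apply: eq_bigr => i _; rewrite -row_mul tr_row !mxE.
by apply: eq_bigr => j _; rewrite !mxE.
Qed.

Lemma posdef_trace_ge0 m n (A : 'M[R]_n) (X : 'M[R]_(m, n)) :
  posdef A -> 0 <= \tr (X *m A *m X^T).
Proof. by move=> hA; rewrite mxtrace_rows sumr_ge0// => i _; exact: posdef_ge0. Qed.

Lemma posdef_trace_eq0 m n (A : 'M[R]_n) (X : 'M[R]_(m, n)) :
  posdef A -> \tr (X *m A *m X^T) = 0 -> X = 0.
Proof.
move=> hA; rewrite mxtrace_rows => /eqP; rewrite psumr_eq0; last first.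
  by move=> i _; exact: posdef_ge0.
move=> /allP h; apply/row_matrixP => i; rewrite row0; apply/eqP.
apply: contraT => /(hA.2); have := h i (mem_index_enum _).
by move=> /= /eqP ->; rewrite ltxx.
Qed.

(* The trace of [X^T (S X + X T)] is a sum of two nonnegative terms. *)
Lemma sylvester_inj n (S T X : 'M[R]_n) : posdef S -> posdef T ->
  S *m X + X *m T = 0 -> X = 0.
Proof.
move=> hS hT h.
have : \tr (X^T *m S *m X) + \tr (X *m T *m X^T) = 0.
  rewrite [X in _ + X]mxtrace_mulC -mxtraceD -!mulmxA -mulmxDr h mulmx0.
  by rewrite mxtrace0.
move/eqP; rewrite paddr_eq0 ?posdef_trace_ge0//; last first.
  by have := posdef_trace_ge0 X^T hS; rewrite trmxK.
by move=> /andP[_ /eqP]; exact: posdef_trace_eq0.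
Qed.

Lemma poly_interpolation (s : seq R) (f : R -> R) :
  exists p : {poly R}, {in s, forall x, p.[x] = f x}.
Proof.
elim: s => [|a s [p hp]]; first by exists 0.
have [as_|as_] := boolP (a \in s).
  by exists p => x; rewrite inE => /orP[/eqP->|]; exact: hp.
pose q := \prod_(y <- s) ('X - y%:P).
have qa : q.[a] != 0 by rewrite -/(root q a) root_prod_XsubC.
exists (p + ((f a - p.[a]) / q.[a])%:P * q) => x; rewrite inE.
rewrite hornerD hornerM hornerC => /orP[/eqP->|xs].
  by rewrite divfK// addrC subrK.
have /eqP -> : root q x by rewrite root_prod_XsubC.
by rewrite mulr0 addr0 hp.
Qed.

Lemma trmx_horner_mx n (A : 'M[R]_n.+1) p : (horner_mx A p)^T = horner_mx A^T p.
Proof.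
elim/poly_ind: p => [|p c IH]; first by rewrite !rmorph0 trmx0.
rewrite !rmorphD !rmorphM /= !horner_mx_X !horner_mx_C linearD/= tr_scalar_mx.
rewrite trmx_mul IH; congr (_ + _).
exact: (comm_mx_horner p (comm_mx_refl A^T)).
Qed.

Lemma posdef_eigenvalue n (A : 'M[R]_n) a : posdef A -> eigenvalue A a -> 0 < a.
Proof.
move=> [_ hA] /eigenvalueP[v vA v0].
have := hA v v0; rewrite vA -scalemxAl mxE.
by have := (posdef1 n).2 v v0; rewrite mulmx1 => vv; rewrite pmulr_lgt0.
Qed.

(** [s] is the spectrum: since [A] is diagonalizable, a polynomial in [A] depends only on its values
    on [s]. Unitary diagonalization is applied to the complexification of [A], then pulled back to
    the reals. *)
Lemma posdef_spectrum n (A : 'M[R]_n.+1) : posdef A ->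
  exists2 s : seq R, {in s, forall a, 0 < a} &
    forall p : {poly R}, {in s, forall a, p.[a] = 0} -> horner_mx A p = 0.
Proof.
move=> hA.
pose io : {rmorphism R -> R[i]} := real_complex R.
pose A' := map_mx io A.
have realA : A' \is a realmx.
  by apply/mxOverP => i j; rewrite mxE complex_real.
have hermA : A' \is hermsymmx.
  apply: realsym_hermsym => //; apply/is_hermitianmxP.
  by rewrite expr0 scale1r map_mx_id// /A' map_trmx hA.1.
have /orthomx_spectralP := hermitian_normalmx hermA.
have := hermitian_spectral_diag_real hermA.
set d := spectral_diag A'; set P := spectralmx A' => /mxOverP dreal AE.
have Pu : P \in unitmx by exact: spectral_unit.
clearbody P d.
(* A real eigenvalue of the complexification is a root of the characteristic polynomial of [A],
   hence an eigenvalue of [A] itself, hence positive. *)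
have de i : exists2 r, d 0 i = io r & 0 < r.
  have /complex_realP[r dr] := dreal 0 i; exists r => //.
  apply: (posdef_eigenvalue hA).
  rewrite eigenvalue_root_char -(fmorph_root io) map_char_poly.
  rewrite -eigenvalue_root_char; apply/eigenvalueP; exists (row i P).
    rewrite -/A' -row_mul [X in _ *m X]AE !mulmxA mulmxV// mul1mx.
    by rewrite row_mul row_diag_mx dr -scalemxAl -rowE.
  apply/negP => /eqP/(congr1 (mulmx^~ (invmx P))).
  rewrite mul0mx rowE -mulmxA mulmxV// mulmx1.
  by move/rowP/(_ i)/eqP; rewrite !mxE !eqxx oner_eq0.
exists [seq complex.Re (d 0 i) | i <- enum 'I_n.+1] => [a|p hp].
  by move=> /mapP[i _ ->]; have [r -> ] := de i.
apply: (map_mx_inj (f := io)); rewrite raddf0 map_horner_mx -/A' AE.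
have Pu' : P \is a GRing.unit by [].
rewrite (horner_mx_uconjC _ _ Pu') horner_mx_diag.
have -> : map_mx (horner (map_poly io p)) d = 0.
  apply/rowP => i; rewrite !mxE; have [r dr _] := de i.
  rewrite dr horner_map /= hp//.
  by apply/mapP; exists i; rewrite ?mem_enum// dr.
by rewrite raddf0 mulmx0 mul0mx.
Qed.

(* [S] is the square of the fourth root of [A], which makes it positive; both
   are polynomials in [A], hence symmetric. *)
Lemma posdef_sqrt_ex n (A : 'M[R]_n) : posdef A ->
  exists2 S, posdef S & S *m S = A.
Proof.
(* Polynomials in a matrix require nonzero size; the empty matrix is its own root. *)
case: n A => [|n] A hA; first by exists A => //; apply/matrixP => -[].
have [s s0 hs] := posdef_spectrum hA.
have [p hp] := poly_interpolation s (fun a => Num.sqrt (Num.sqrt a)).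
pose T := horner_mx A p.
have TT : T *m T *m (T *m T) = A.
  apply/eqP; rewrite -subr_eq0; apply/eqP.
  rewrite -[X in _ - X]horner_mx_X -[_ *m _]/(T * T * (T * T)) -!rmorphM -rmorphB.
  apply: hs => a sa.
  rewrite hornerD hornerN hornerX !hornerM hp// -!expr2.
  by rewrite !sqr_sqrtr ?sqrtr_ge0 ?subrr// ltW// s0.
have Tt : T^T = T by rewrite trmx_horner_mx hA.1.
have Tu : T \in unitmx.
  have := posdef_unit hA; rewrite -TT !unitmx_mul.
  by case/andP => /andP[].
exists (T *m T) => //.
have := posdef_congr Tu (posdef1 _); by rewrite mulmx1 Tt.
Qed.

(** For positive [A] the choice is forced: two positive roots S and T satisfy S (S - T) + (S - T) T
    = 0, and [sylvester_inj] gives S = T. *)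
Definition sqrtmx n (A : 'M[R]_n) : 'M[R]_n := get [set S | posdef S /\ S *m S = A].

Lemma sqrtmxP n (A : 'M[R]_n) : posdef A ->
  posdef (sqrtmx A) /\ sqrtmx A *m sqrtmx A = A.
Proof.
move=> /posdef_sqrt_ex[S hS SA].
exact: (@getPex _ [set S | posdef S /\ S *m S = A] (ex_intro _ S (conj hS SA))).
Qed.

End PosDef.

(** * Lipschitz estimate for the square root *)

Section MxNorm.
Context {R : realType}.

Lemma ler_mx_norm m n (A : 'M[R]_(m, n)) i j : `|A i j| <= `|A|.
Proof.
rewrite [leRHS]/Num.Def.normr/= mx_normrE.
exact: (le_bigmax _ (fun ij : 'I_m * 'I_n => `|A ij.1 ij.2|) (i, j)).
Qed.

Lemma mx_norm_ler m n (A : 'M[R]_(m, n)) e :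
  0 <= e -> (forall i j, `|A i j| <= e) -> `|A| <= e.
Proof.
move=> e0 h; rewrite [leLHS]/Num.Def.normr/= mx_normrE.
by apply: bigmax_le => // -[i j] _; exact: h.
Qed.

Lemma mx_norm_mulmx m n p (A : 'M[R]_(m, n)) (B : 'M[R]_(n, p)) :
  `|A *m B| <= n%:R * (`|A| * `|B|).
Proof.
apply: mx_norm_ler => [|i j]; first by rewrite !mulr_ge0.
rewrite mxE (le_trans (ler_norm_sum _ _ _))//.
rewrite -[X in X%:R](card_ord n) mulr_natl -sumr_const ler_sum// => k _.
by rewrite normrM ler_pM// ler_mx_norm.
Qed.

Lemma mx_norm_trmx m n (A : 'M[R]_(m, n)) : `|A^T| <= `|A|.
Proof. by apply: mx_norm_ler => // i j; rewrite mxE ler_mx_norm. Qed.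

(** The trace is the square of the Frobenius norm, which dominates the sup norm. *)
Lemma mx_norm_sqr_le m n (A : 'M[R]_(m, n)) : `|A| ^+ 2 <= \tr (A *m A^T).
Proof.
have h i j : A i j ^+ 2 <= \tr (A *m A^T).
  rewrite /mxtrace (bigD1 i)//= mxE (bigD1 j)//= !mxE -expr2 -addrA lerDl.
  rewrite addr_ge0 ?sumr_ge0// => k _; first by rewrite mxE -expr2 sqr_ge0.
  by rewrite mxE sumr_ge0// => l _; rewrite mxE -expr2 sqr_ge0.
have t0 : 0 <= \tr (A *m A^T).
  rewrite sumr_ge0// => k _; rewrite mxE sumr_ge0// => l _.
  by rewrite mxE -expr2 sqr_ge0.
rewrite -[leRHS](sqr_sqrtr t0) lerXn2r ?nnegrE ?sqrtr_ge0//.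
apply: mx_norm_ler => [|i j]; first exact: sqrtr_ge0.
by rewrite -sqrtr_sqr ler_sqrt.
Qed.

Lemma mxtrace_le n (A : 'M[R]_n) : \tr A <= n%:R * `|A|.
Proof.
rewrite -[X in X%:R](card_ord n) mulr_natl -sumr_const ler_sum// => i _.
by rewrite (le_trans (ler_norm _))// ler_mx_norm.
Qed.

(* With [D = S - T], where [S] and [T] are the roots, [S D + D T = B - A], hence
   [tr (D T D^T) <= tr (D^T (B - A))]; the left-hand side controls [|D|^2]. *)
Lemma sqrtmx_lipschitz n (A : 'M[R]_n) : posdef A ->
  exists2 c : R, 0 < c &
    forall B, posdef B -> `|sqrtmx B - sqrtmx A| <= c * `|B - A|.
Proof.
move=> hA; have [hT TA] := sqrtmxP hA; have [hQ QT] := sqrtmxP hT.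
set T := sqrtmx A in hT TA hQ QT *; set Q := sqrtmx T in hQ QT.
have [Qt _] := hQ; have Qu := posdef_unit hQ.
pose a : R := n%:R * `|invmx Q|.
have a0 : 0 <= a by rewrite mulr_ge0.
(* Since Q Q = T, tr (D T D^T) is the squared Frobenius norm of D Q. Then |D| <= a |D Q| and |D Q|^2
   <= n^2 |D| |E|, and |D| is divided out. The [+ 1] keeps the constant positive when [n] is 0. *)
exists (a ^+ 2 * n%:R ^+ 2 + 1) => [|B hB].
  by rewrite ltr_wpDl// mulr_ge0 ?sqr_ge0.
have [hS SB] := sqrtmxP hB; set S := sqrtmx B in hS SB *.
set D := S - T; set E := B - A.
have DE : S *m D + D *m T = E.
  by rewrite mulmxBr mulmxBl addrA subrK SB TA.
have h1 : `|D| <= a * `|D *m Q|.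
  rewrite -[in leLHS](mulmxK Qu D) (le_trans (mx_norm_mulmx _ _))//.
  by rewrite /a -mulrA (mulrC `|invmx Q|).
have h2 : `|D *m Q| ^+ 2 <= n%:R ^+ 2 * (`|D| * `|E|).
  rewrite (le_trans (mx_norm_sqr_le _))// trmx_mul Qt mulmxA -(mulmxA D) QT.
  have : \tr (D *m T *m D^T) <= \tr (D^T *m E).
    rewrite -DE mulmxDr mxtraceD mulmxA [X in _ <= _ + X]mxtrace_mulC.
    rewrite lerDr; have := posdef_trace_ge0 D^T hS.
    by rewrite trmxK.
  move=> /le_trans -> //; rewrite (le_trans (mxtrace_le _))//.
  rewrite expr2 -mulrA ler_wpM2l// (le_trans (mx_norm_mulmx _ _))//.
  by rewrite ler_wpM2l// ler_wpM2r// mx_norm_trmx.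
have [->|D0] := eqVneq D 0; first by rewrite normr0 mulr_ge0// addr_ge0// mulr_ge0 ?sqr_ge0.
have nD : 0 < `|D| by rewrite normr_gt0.
rewrite -(ler_pM2l nD) -expr2.
have h3 : `|D| ^+ 2 <= (a * `|D *m Q|) ^+ 2 by rewrite lerXn2r ?nnegrE// mulr_ge0.
rewrite (le_trans h3)// exprMn (le_trans (ler_wpM2l (sqr_ge0 a) h2))//.
rewrite mulrDl mul1r mulrDr.
apply: le_trans (_ : `|D| * (a ^+ 2 * n%:R ^+ 2 * `|E|) <= _).
  by rewrite le_eqVlt; apply/orP; left; apply/eqP; ring.
by rewrite lerDl mulr_ge0.
Qed.

End MxNorm.

(** * Smoothness of the square root *)

Section SqrtSmooth.
Context {R : realType} {V : normedModType R} {n : nat}.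

(** The operator X -> S X + X T is made into a matrix so that [Cn_on_invmx] controls its inverse. *)
Definition sylvester_mx (S T : 'M[R]_n) : 'M[R]_(n * n) :=
  lin_mulmx S + lin_mulmxr T.

Lemma mxvec_sylvester S T X :
  mxvec X *m sylvester_mx S T = mxvec (S *m X + X *m T).
Proof. by rewrite mulmxDr !mul_vec_lin /= linearD. Qed.

Lemma sylvester_unit S T : posdef S -> posdef T -> sylvester_mx S T \in unitmx.
Proof.
move=> hS hT; rewrite -row_free_unit -kermx_eq0.
apply/negPn/negP => /rowV0Pn[v /sub_kermxP].
rewrite -{1}(vec_mxK v) mxvec_sylvester => /eqP h /negP; apply.
move: h; rewrite mxvec_eq0 => /eqP/(sylvester_inj hS hT) => v0.
by rewrite -(vec_mxK v) v0 linear0.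
Qed.

Lemma Cn_on_sylvester k (U : set V) (S T : V -> 'M[R]_n) : open U ->
  Cn_on k U S -> Cn_on k U T -> Cn_on k U (fun x => sylvester_mx (S x) (T x)).
Proof.
move=> oU cS cT; apply: Cn_onD => //.
  apply/Cn_on_mxP => // i j; under eq_fun do rewrite !mxE.
  case/mxvec_indexP: j => a b; under eq_fun do rewrite mxvecE.
  apply: Cn_on_entry => //; apply: Cn_on_mulmx => //; exact: Cn_on_cst.
apply/Cn_on_mxP => // i j; under eq_fun do rewrite !mxE.
case/mxvec_indexP: j => a b; under eq_fun do rewrite mxvecE.
apply: Cn_on_entry => //; apply: Cn_on_mulmx => //; exact: Cn_on_cst.
Qed.

(* If [S] is the root of [F], the increment of [S] from x to y solves the Sylvester
   equation [S(y) X + X S(x) = F(y) - F(x)], hence is the increment of [F] times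
   a continuous matrix; the same equation at x gives the derivative of [S] and
   the induction on the order of differentiability. *)
Lemma Cn_on_sqrtmx k (U : set V) (F : V -> 'M[R]_n) : open U ->
  {in U, forall x, posdef (F x)} ->
  Cn_on k U F -> Cn_on k U (fun x => sqrtmx (F x)).
Proof.
move=> oU hF; have pF x : U x -> posdef (F x) by move=> Ux; apply: hF; rewrite inE.
pose S x := sqrtmx (F x).
have hS x : U x -> posdef (S x) by move=> /pF/sqrtmxP[].
have SE x : U x -> S x *m S x = F x by move=> /pF/sqrtmxP[].
have nU x : U x -> \forall y \near x, U y by move=> Ux; exact: open_nbhs_nbhs.
elim: k => [|k IH] cF.
  move=> x Ux; apply/cvgrPdist_le => e e0.
  have [c c0 hc] := sqrtmx_lipschitz (pF _ Ux).
  have ec : 0 < e / c by rewrite divr_gt0.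
  have /cvgrPdist_le/(_ _ ec) Fc := cF _ Ux.
  have nUx := nU _ Ux.
  near=> y.
  have Uy : U y by near: y.
  rewrite distrC (le_trans (hc _ (pF _ Uy)))// mulrC -ler_pdivlMr//.
  by rewrite distrC; near: y.
have cS := IH (Cn_onW cF); have [dF cdF] := cF.
have c0S : Cn_on 0 U S.
  by elim: (k) cS => // l IHl /Cn_onW.
have dS x : U x -> differentiable S x.
  move=> Ux; apply/differentiable_mxP => i j.
  pose h l y : R := mxvec (F y - F x) 0 l.
  pose q l y : R := invmx (sylvester_mx (S y) (S x)) l (mxvec_index i j).
  have nUx := nU _ Ux.
  apply: (@near_eq_differentiable _ _ _ (cst (S x i j) + \sum_l (q l * h l))).
    near=> y; have Uy : U y by near: y.
    rewrite !fctE /= fct_sumE.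
    have : mxvec (S y - S x) *m sylvester_mx (S y) (S x) = mxvec (F y - F x).
      by rewrite mxvec_sylvester mulmxBr mulmxBl addrA subrK !SE.
    move/(congr1 (mulmx^~ (invmx (sylvester_mx (S y) (S x))))).
    rewrite mulmxK; last by apply: sylvester_unit; exact: hS.
    move/rowP/(_ (mxvec_index i j)); rewrite mxvecE !mxE => SS.
    rewrite -[RHS](subrK (S x i j)) SS addrC; congr (_ + _).
    by apply: eq_bigr => l _; rewrite mulrC.
  apply: differentiableD => //; apply: differentiable_sum => l.
  apply: differentiable_continuous_mul0.
  - have : Cn_on 0 U (fun y => invmx (sylvester_mx (S y) (S x))).
      apply: Cn_on_invmx => // [y|]; last first.
        by apply: Cn_on_sylvester => //; exact: Cn_on_cst.
      by rewrite inE => Uy; apply: sylvester_unit; exact: hS.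
    by move/Cn_on_mxP => /(_ oU l (mxvec_index i j)); exact.
  - rewrite /h; case/mxvec_indexP: l => a b.
    rewrite (_ : (fun y => _) = fun y => (F y - F x) a b); last first.
      by apply/funext => y; rewrite mxvecE.
    have : differentiable (F - cst (F x)) x.
      by apply: differentiableB => //; exact: dF.
    by move/differentiable_mxP/(_ a b).
  - by rewrite /h subrr linear0 mxE.
split=> // v.
have SylSF x : U x ->
    'D_v S x = vec_mx (mxvec ('D_v F x) *m invmx (sylvester_mx (S x) (S x))).
  move=> Ux; have := derive_mulmx v (dS _ Ux) (dS _ Ux).
  have -> : 'D_v (fun y => S y *m S y) x = 'D_v F x.
    apply: near_eq_derive; near=> y; apply: SE; near: y; exact: nU.
  rewrite addrC => /(congr1 mxvec); rewrite -mxvec_sylvester => ->.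
  by rewrite mulmxK ?mxvecK// sylvester_unit//; exact: hS.
apply: (@Cn_on_eq _ _ _ _ _
  (fun x => vec_mx (mxvec ('D_v F x) *m invmx (sylvester_mx (S x) (S x))))) => //.
  by move=> x; rewrite inE => Ux; rewrite -SylSF.
apply/Cn_on_mxP => // i j; under eq_fun do rewrite mxE.
apply: Cn_on_entry => //; apply: Cn_on_mulmx => //.
  apply/Cn_on_mxP => // a l; rewrite ord1; case/mxvec_indexP: l => b c.
  under eq_fun do rewrite mxvecE.
  by apply: Cn_on_entry => //; exact: cdF.
apply: Cn_on_invmx => //; last exact: Cn_on_sylvester.
by move=> x; rewrite inE => Ux; apply: sylvester_unit; exact: hS.
Unshelve. all: by end_near.
Qed.

End SqrtSmooth.

(** * Orientation of the kernel of an almost contact endomorphism *)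

Section Frames.
Context {R : realType} {n : nat}.
Local Notation N := (n + n + 1)%N.

(* Over the complex numbers the matrix is similar to a triangular one with
   diagonal blocks [A + iB] and [A - iB], whose determinants are conjugate. *)
Lemma det_complex_block_ge0 m (A B : 'M[R]_m) : 0 <= \det (block_mx A B (- B) A).
Proof.
pose io : {rmorphism R -> R[i]} := real_complex R.
pose A' := map_mx io A; pose B' := map_mx io B; pose j : R[i] := 'i%C.
have jj : j * j = -1 by rewrite -expr2 sqr_i.
pose Z := A' + j *: B'.
have E : block_mx 1%:M (- j%:M) 0 1%:M *m map_mx io (block_mx A B (- B) A)
    *m block_mx 1%:M j%:M 0 1%:M = block_mx Z 0 (- B') (map_mx (@conjc R) Z).
  rewrite map_block_mx map_mxN -/A' -/B' !mulmx_block.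
  rewrite !mul1mx !mul0mx !mulmx1 !mulmx0 !add0r !addr0 !mulmxN !mulNmx opprK.
  rewrite !mul_scalar_mx !mul_mx_scalar; congr block_mx.
    by rewrite scalerDr scalerA jj scaleN1r addrA subrK subrr.
  rewrite map_mxD map_mxZ /= addrC; congr (_ + _).
    by apply/matrixP => a b; rewrite !mxE conjc_real.
  rewrite -scaleNr; congr (_ *: _); first by rewrite /j; simpc.
  by apply/matrixP => a b; rewrite !mxE conjc_real.
have := congr1 (fun M => \det M) E.
rewrite !det_mulmx det_lblock !det_ublock !det1 !mul1r !mulr1 det_map_mx => h.
rewrite -ler0c -[_%:C%C]/(io _) h det_map_mx; exact: mulcJ_ge0.
Qed.

(** Listing all of [v] before all of [v *m phi], instead of interleaving them, alters the complex
    orientation by a sign that depends on [n] only, hence consistently over the manifold. *)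
Definition frame (phi : 'M[R]_N) (xi : 'rV[R]_N) (v : 'M[R]_(n, N)) : 'M[R]_N :=
  col_mx (col_mx v (v *m phi)) xi.

(* [xi] followed by the complex orientation of the image of [phi] is positive. *)
Definition positive_kernel (phi : 'M[R]_N) (xi : 'rV[R]_N) : Prop :=
  exists2 v : 'M[R]_(n, N), v *m phi *m phi = - v & 0 < \det (frame phi xi v).

(* Two frames differ by a block matrix commuting with the complex structure. *)
Lemma frame_sign phi xi v w : xi *m phi = 0 ->
  v *m phi *m phi = - v -> w *m phi *m phi = - w ->
  0 < \det (frame phi xi v) -> 0 <= \det (frame phi xi w).
Proof.
move=> xip vpp wpp dv.
have vu : frame phi xi v \in unitmx by rewrite unitmxE unitfE gt_eqF.
pose C := w *m invmx (frame phi xi v).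
pose A := lsubmx (lsubmx C); pose B := rsubmx (lsubmx C).
have wE : w = A *m v + B *m (v *m phi) + rsubmx C *m xi.
  rewrite -[LHS](mulmxKV vu) -/C -[in LHS](hsubmxK C) -[lsubmx C in LHS]hsubmxK.
  by rewrite /frame !mul_row_col.
(* - phi^2 fixes [w], [v] and [v *m phi] and kills [xi]: there is no component along [xi]. *)
have wE' : w = A *m v + B *m (v *m phi).
  have := congr1 (fun M => - (M *m phi *m phi)) wE.
  rewrite wpp opprK => ->; rewrite !mulmxDl -(mulmxA _ xi) xip mulmx0 mul0mx addr0.
  rewrite -(mulmxA A v) -(mulmxA A (v *m phi)) -(mulmxA B (v *m phi)) vpp.
  by rewrite !mulmxN mulNmx -opprD opprK mulmxA.
have wp : w *m phi = - B *m v + A *m (v *m phi).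
  rewrite wE' mulmxDl addrC; congr (_ + _); last by rewrite mulmxA.
  by rewrite -!mulmxA (mulmxA v) vpp mulmxN mulNmx.
have -> : frame phi xi w =
    block_mx (block_mx A B (- B) A) 0 0 1%:M *m frame phi xi v.
  rewrite /frame mul_block_col !mul0mx mul1mx add0r addr0 mul_block_col.
  by rewrite -wE' -wp.
rewrite det_mulmx det_ublock det1 mulr1 mulr_ge0 //; last exact: ltW.
exact: det_complex_block_ge0.
Qed.

Lemma det_frameN phi xi v : \det (frame phi (- xi) v) = - \det (frame phi xi v).
Proof.
have -> : frame phi (- xi) v = block_mx 1%:M 0 0 (- 1)%:M *m frame phi xi v.
  rewrite /frame mul_block_col !mul0mx mul1mx add0r addr0.
  by rewrite mul_scalar_mx scaleN1r.
by rewrite det_mulmx det_ublock det1 det_scalar expr1 mul1r mulN1r.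
Qed.

Lemma row_free_ker0 (F : fieldType) m p (A : 'M[F]_(m, p)) :
  (forall x : 'rV_m, x *m A = 0 -> x = 0) -> row_free A.
Proof.
move=> h; rewrite -kermx_eq0; apply/negPn/negP => /rowV0Pn[v /sub_kermxP].
by move/h => ->; rewrite eqxx.
Qed.

Lemma row_free_eq0 (F : fieldType) m p q (A : 'M[F]_(m, p))
    (x : 'M[F]_(q, m)) :
  row_free A -> x *m A = 0 -> x = 0.
Proof. by move=> /row_free_inj Ai xA; apply: Ai; rewrite /= mul0mx. Qed.

(* If u is outside the phi-invariant span S of [v; v phi], then so are all the
   nonzero combinations b u + d (u phi), as multiplying by b - d phi gives
   (b^2 + d^2) u. *)
Lemma frame_ex phi xi (eta : 'cV[R]_N) : xi *m phi = 0 ->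
  (xi *m eta) 0 0 = 1 -> phi *m phi = - 1%:M + eta *m xi ->
  exists2 v : 'M[R]_(n, N), v *m phi *m phi = - v & frame phi xi v \in unitmx.
Proof.
move=> xip xieta pp.
have pppp : phi *m phi *m phi = - phi.
  by rewrite {1}pp mulmxDl -mulmxA xip mulmx0 addr0 mulNmx mul1mx.
have [v vpp vfree] : exists2 v : 'M[R]_(n, N), v *m phi *m phi = - v &
    row_free (col_mx v (v *m phi)).
  suff H k : (k <= n)%N -> exists2 v : 'M[R]_(k, N), v *m phi *m phi = - v &
    row_free (col_mx v (v *m phi)) by exact: H.
  elim: k => [_|k IH kn].
    exists 0; first by rewrite !mul0mx oppr0.
    by apply: row_free_ker0 => x _; apply/rowP => -[].
  have [v vpp vfree] := IH (ltnW kn).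
  set S := col_mx v (v *m phi) in vfree.
  have Sphi : S *m phi = block_mx 0 1%:M (- 1%:M) 0 *m S.
    rewrite mul_col_mx mul_block_col !mul0mx mul1mx add0r addr0 vpp.
    by rewrite mulNmx mul1mx.
  have Sinv m (x : 'M[R]_(m, N)) : (x <= S)%MS -> (x *m phi <= S)%MS.
    by move=> /submxP[D ->]; rewrite -mulmxA Sphi mulmxA submxMl.
  (* Otherwise 1 = - phi^2 + eta xi would have rank at most 2k + 1 < 2n + 1. A row of phi^2 outside
     S is then the next vector u. *)
  have nS : ~~ (phi *m phi <= S)%MS.
    apply/negP => ppS.
    have : (1%:M <= S + xi)%MS.
      have -> : 1%:M = - (phi *m phi) + eta *m xi by rewrite pp opprD opprK subrK.
      rewrite addmx_sub_adds ?submxMl// eqmx_opp.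
      exact: ppS.
    move/mxrankS; rewrite mxrank1 => /leq_trans/(_ (mxrank_adds_leqif _ _)).
    move/leq_trans/(_ (leq_add (rank_leq_row _) (rank_leq_row _))).
    by rewrite leqNgt !ltn_add2r => /negP; apply; rewrite -addSn leq_add // ltnW.
  have [i inS] := row_subPn nS.
  pose u := row i (phi *m phi).
  have upp : u *m phi *m phi = - u.
    by rewrite /u -!row_mul pppp mulNmx !linearN.
  have v'pp : col_mx v u *m phi *m phi = - col_mx v u.
    by rewrite !mul_col_mx vpp upp opp_col_mx.
  rewrite -addn1.
  exists (col_mx v u) => //; apply: row_free_ker0 => x.
  rewrite -[x]hsubmxK mul_row_col -[lsubmx x]hsubmxK -[rsubmx x]hsubmxK.
  set a := lsubmx (lsubmx x); set b := rsubmx (lsubmx x).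
  set c := lsubmx (rsubmx x); set d := rsubmx (rsubmx x).
  rewrite mul_col_mx !mul_row_col => h.
  have h1 : row_mx a c *m S + (b *m u + d *m (u *m phi)) = 0.
    rewrite -[RHS]h mul_row_col -!addrA; congr (_ + _).
    by rewrite addrCA.
  have hS : ((b *m u + d *m (u *m phi))%R <= S)%MS.
    have -> : b *m u + d *m (u *m phi) = - (row_mx a c *m S).
      by apply/eqP; rewrite -subr_eq0 opprK addrC h1.
    by rewrite eqmx_opp submxMl.
  pose b0 := b 0 0; pose d0 := d 0 0.
  have bE : b = b0%:M by rewrite [LHS]mx11_scalar.
  have dE : d = d0%:M by rewrite [LHS]mx11_scalar.
  move: hS; rewrite bE dE !mul_scalar_mx => hS.
  have hS2 := Sinv _ _ hS.
  have : ((b0 ^+ 2 + d0 ^+ 2) *: u <= S)%MS.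
    have -> : (b0 ^+ 2 + d0 ^+ 2) *: u =
       b0 *: (b0 *: u + d0 *: (u *m phi)) - d0 *: ((b0 *: u + d0 *: (u *m phi)) *m phi).
      rewrite mulmxDl -!scalemxAl upp !scalerDr !scalerA !scalerN opprD opprK.
      by rewrite scalerDl (mulrC d0 b0) addrA addrK !expr2.
    by rewrite addmx_sub ?eqmx_opp ?scalemx_sub.
  have [bd0 _|bd] := eqVneq (b0 ^+ 2 + d0 ^+ 2) 0; last first.
    by rewrite (eqmx_scale _ bd) (negPf inS).
  move/eqP: bd0; rewrite paddr_eq0 ?sqr_ge0// !sqrf_eq0 => /andP[/eqP b00 /eqP d00].
  move: h1; rewrite bE dE b00 d00 !mul_scalar_mx !scale0r !addr0.
  move/(row_free_eq0 vfree)/eqP; rewrite row_mx_eq0 => /andP[/eqP -> /eqP ->].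
  by rewrite raddf0 !row_mx0.
exists v => //; rewrite -row_free_unit; apply: row_free_ker0 => x.
rewrite -[x]hsubmxK /frame mul_row_col => h.
(* phi^2 removes the component along [xi]; once the others vanish, [eta] detects the coefficient of
   [xi]. *)
have h1 : lsubmx x *m col_mx v (v *m phi) = 0.
  have := congr1 (fun M => M *m phi *m phi) h.
  rewrite /= !mul0mx !mulmxDl -(mulmxA _ xi) xip mulmx0 mul0mx addr0.
  rewrite -(mulmxA _ (col_mx _ _)) -(mulmxA _ (_ *m _)) !mul_col_mx vpp mulNmx.
  by rewrite -opp_col_mx mulmxN => /eqP; rewrite oppr_eq0 => /eqP.
move: h; rewrite h1 add0r (row_free_eq0 vfree h1) => h.
have -> : rsubmx x = 0; last by rewrite row_mx0.
have := congr1 (fun M => M *m eta) h.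
by rewrite /= mul0mx -mulmxA (mx11_scalar (xi *m eta)) xieta mulmx1.
Qed.

Lemma positive_kernel_or phi xi (eta : 'cV[R]_N) : xi *m phi = 0 ->
  (xi *m eta) 0 0 = 1 -> phi *m phi = - 1%:M + eta *m xi ->
  positive_kernel phi xi \/ positive_kernel phi (- xi).
Proof.
move=> h1 h2 h3; have [v vpp] := frame_ex h1 h2 h3.
rewrite unitmxE unitfE neq_lt => /orP[d|d]; [right|left]; exists v => //.
by rewrite det_frameN oppr_gt0.
Qed.

(** Together with [positive_kernel_or], exactly one of [xi] and [- xi] is positive. *)
Lemma positive_kernel_opp phi xi : xi *m phi = 0 ->
  positive_kernel phi xi -> ~ positive_kernel phi (- xi).
Proof.
move=> h [v vp dv] [w wp]; rewrite det_frameN oppr_gt0 ltNge => /negP; apply.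
exact: frame_sign dv.
Qed.

(** In the new basis a frame is multiplied by [invmx C]. This is where orientability enters. *)
Lemma positive_kernel_change phi xi (C : 'M[R]_N) : 0 < \det C ->
  positive_kernel phi xi ->
  positive_kernel (C *m phi *m invmx C) (xi *m invmx C).
Proof.
move=> dC [v vp dv].
have Cu : C \in unitmx by rewrite unitmxE unitfE gt_eqF.
have E : v *m invmx C *m (C *m phi *m invmx C) = v *m phi *m invmx C.
  by rewrite !mulmxA mulmxKV.
exists (v *m invmx C).
  by rewrite E !mulmxA mulmxKV// vp mulNmx.
rewrite /frame E -!mul_col_mx det_mulmx mulr_gt0//.
by rewrite det_inv invr_gt0.
Qed.

End Frames.

(** * Polar decomposition of a skew-symmetric endomorphism *)

Section Polar.
Context {R : realType} {N : nat}.
Implicit Types (g A S T C theta Pi : 'M[R]_N).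

(* The square root of [A] among the positive endomorphisms self-adjoint for the
   metric [g], obtained by conjugating [g] to the identity. *)
Definition gsqrt g A : 'M[R]_N :=
  sqrtmx g *m sqrtmx (invmx (sqrtmx g) *m A *m sqrtmx g) *m invmx (sqrtmx g).

(** [posdef (A *m g)] says that [A] is self-adjoint and positive for [g]. If H is the root of [g],
    then H^-1 A H = H^-1 (A g) H^-1 is congruent to [A *m g]. *)
Lemma posdef_conj g A : posdef g -> posdef (A *m g) ->
  posdef (invmx (sqrtmx g) *m A *m sqrtmx g).
Proof.
move=> hg hA; have [hH HE] := sqrtmxP hg; set H := sqrtmx g in hH HE *.
have Hu := posdef_unit hH.
have := posdef_congr (P := invmx H) _ hA; rewrite unitmx_inv => /(_ Hu).
by rewrite trmx_inv hH.1 -{1}HE !mulmxA mulmxK.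
Qed.

Lemma gsqrtP g A : posdef g -> posdef (A *m g) ->
  posdef (gsqrt g A *m g) /\ gsqrt g A *m gsqrt g A = A.
Proof.
move=> hg hA; have := sqrtmxP (posdef_conj hg hA); rewrite /gsqrt.
have [hH HE] := sqrtmxP hg; set H := sqrtmx g in hH HE *.
have Hu := posdef_unit hH.
set s := sqrtmx (invmx H *m A *m H) => -[hs ss]; split.
  have := posdef_congr Hu hs; rewrite hH.1.
  by rewrite -[X in _ -> posdef (_ *m X)]HE !mulmxA mulmxKV.
rewrite !mulmxA mulmxKV// -(mulmxA H) ss !mulmxA mulmxV// mul1mx.
by rewrite mulmxK.
Qed.

Lemma gsylvester_inj g S T X : posdef g -> posdef (S *m g) -> posdef (T *m g) ->
  S *m X + X *m T = 0 -> X = 0.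
Proof.
move=> hg hS hT h; have := posdef_conj hg hT; have := posdef_conj hg hS.
have [hH HE] := sqrtmxP hg; set H := sqrtmx g in hH HE *.
have Hu := posdef_unit hH => hS' hT'.
have := sylvester_inj (X := invmx H *m X *m H) hS' hT'.
rewrite !mulmxA !mulmxK// -mulmxDl -(mulmxA _ S) -(mulmxA _ X T) -mulmxDr h.
rewrite mulmx0 mul0mx => /(_ erefl)/(congr1 (fun Y => H *m Y *m invmx H)).
by rewrite !mulmxA mulmxV// mul1mx mulmxK// mulmx0 mul0mx.
Qed.

Lemma gsqrt_unique g S T : posdef g -> posdef (S *m g) -> posdef (T *m g) ->
  S *m S = T *m T -> S = T.
Proof.
move=> hg hS hT h; apply/eqP; rewrite -subr_eq0; apply/eqP.
apply: (gsylvester_inj hg hS hT).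
by rewrite mulmxBr mulmxBl h addrA subrK subrr.
Qed.

(** The root of [g] used in [gsqrt] does not transform simply under [C], whence the appeal to
    uniqueness: both sides are positive roots of the same endomorphism for the new metric. *)
Lemma gsqrt_change g A C : C \in unitmx -> posdef g -> posdef (A *m g) ->
  gsqrt (C *m g *m C^T) (C *m A *m invmx C) = C *m gsqrt g A *m invmx C.
Proof.
move=> Cu hg hA; have hg' := posdef_congr Cu hg.
have E X : C *m X *m invmx C *m (C *m g *m C^T) = C *m (X *m g) *m C^T.
  by rewrite !mulmxA mulmxKV.
have hA' : posdef (C *m A *m invmx C *m (C *m g *m C^T)).
  by rewrite E; exact: posdef_congr.
have [h1 h2] := gsqrtP hg' hA'; have [h3 h4] := gsqrtP hg hA.
set S := gsqrt g A in h3 h4 *; clearbody S.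
apply: (gsqrt_unique hg' h1); first by rewrite E; exact: posdef_congr.
by rewrite h2 !mulmxA mulmxKV// -(mulmxA C S S) h4.
Qed.

Lemma comm_invmx S theta : S \in unitmx -> S *m theta = theta *m S ->
  invmx S *m theta = theta *m invmx S.
Proof.
move=> Su h.
by rewrite -[theta in LHS](mulmxK Su) -h !mulmxA mulVmx// mul1mx.
Qed.

Lemma invmx_sqr S : S \in unitmx -> invmx S *m invmx S = invmx (S *m S).
Proof.
move=> Su; have SSu : S *m S \in unitmx by rewrite unitmx_mul Su.
by apply: (can_inj (mulKmx SSu)); rewrite mulmxV// !mulmxA mulmxK// mulmxV.
Qed.

(* [g *m xi^T] is the 1-form dual to the unit vector [xi]. *)
Record skew_kernel g theta (xi : 'rV[R]_N) : Prop := {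
  sk_posdef : posdef g;
  sk_skew : theta *m g = - (g *m theta^T);
  sk_ker : xi *m theta = 0;
  sk_unit : (xi *m (g *m xi^T)) 0 0 = 1;
  sk_only : forall v : 'rV_N, v *m theta = 0 -> exists a, v = a *: xi }.

(* [theta] times the inverse of the root of its absolute value squared, to which
   the projection on the kernel is added to make it invertible. *)
Definition polar_part g theta (xi : 'rV[R]_N) : 'M[R]_N :=
  invmx (gsqrt g (g *m xi^T *m xi - theta *m theta)) *m theta.

Section props.
Variables (g theta : 'M[R]_N) (xi : 'rV[R]_N).
Hypothesis sk : skew_kernel g theta xi.
Let eta := g *m xi^T.
Let A := eta *m xi - theta *m theta.
Let S := gsqrt g A.
Let phi := polar_part g theta xi.

Let gt : g^T = g. Proof. by have [] := sk_posdef sk. Qed.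

Let xieta : xi *m eta = 1%:M.
Proof. by rewrite [LHS]mx11_scalar (sk_unit sk). Qed.

Let thetaeta : theta *m eta = 0.
Proof.
by rewrite mulmxA (sk_skew sk) mulNmx -mulmxA -trmx_mul (sk_ker sk) trmx0 mulmx0 oppr0.
Qed.

(** At v the form is the sum of (v eta)^2 and the squared norm of v theta. The latter vanishes only
    on multiples of [xi], where the former does not unless v = 0. *)
Lemma polar_posdef : posdef (A *m g).
Proof.
have Eg : A *m g = eta *m eta^T + theta *m g *m theta^T.
  rewrite mulmxBl -(mulmxA eta); congr (_ + _).
    by congr (_ *m _); rewrite trmx_mul trmxK gt.
  by rewrite -(mulmxA theta theta) [X in - (_ *m X)](sk_skew sk) mulmxN opprK mulmxA.
split.
  rewrite Eg linearD /= (trmx_mul eta) (trmx_mul (theta *m g)) (trmx_mul theta).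
  by rewrite !trmxK gt mulmxA.
move=> v v0; rewrite Eg mulmxDr mulmxDl mxE.
set p := (X in X + _); set q := (X in _ + X).
have pE : p = ((v *m eta) 0 0) ^+ 2.
  rewrite /p (mulmxA v) -(mulmxA (v *m eta)) -(trmx_mul v eta) mxE big_ord1.
  by rewrite [X in _ * X]mxE expr2.
have qE : q = ((v *m theta) *m g *m (v *m theta)^T) 0 0.
  by rewrite /q trmx_mul !mulmxA.
have [vt|vt] := eqVneq (v *m theta) 0; last first.
  by rewrite qE ltr_wpDl ?(sk_posdef sk).2// pE sqr_ge0.
have [a va] := sk_only sk vt.
rewrite qE vt !mul0mx mxE addr0 pE va -scalemxAl xieta !mxE mulr1 exprn_even_gt0//=.
by apply: contra v0 => /eqP a0; rewrite va a0 scale0r.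
Qed.

Let hS := (gsqrtP (sk_posdef sk) polar_posdef).1.
Let SS := (gsqrtP (sk_posdef sk) polar_posdef).2.

Lemma polar_unit : S \in unitmx.
Proof. by have := posdef_unit hS; rewrite unitmx_mul => /andP[]. Qed.

Let Aeta : A *m eta = eta.
Proof. by rewrite mulmxBl -!mulmxA xieta thetaeta mulmx1 mulmx0 subr0. Qed.

Let Sg : S *m g = g *m S^T.
Proof. by have [h _] := hS; rewrite -[LHS]h trmx_mul gt. Qed.

(** X = S theta - theta S satisfies S X + X S = A theta - theta A = 0. *)
Lemma polar_comm : S *m theta = theta *m S.
Proof.
apply/eqP; rewrite -subr_eq0; apply/eqP.
apply: (gsylvester_inj (sk_posdef sk) hS hS).
have A1 : A *m theta = theta *m A.
  rewrite mulmxBl mulmxBr -(mulmxA eta) (sk_ker sk) mulmx0 (mulmxA theta eta).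
  by rewrite thetaeta mul0mx -mulmxA.
have E (X : 'M[R]_N) : X *m (X *m theta - theta *m X) + (X *m theta - theta *m X) *m X
    = X *m X *m theta - theta *m (X *m X).
  by rewrite mulmxBr mulmxBl !mulmxA addrA subrK.
by rewrite E SS A1 subrr.
Qed.

Lemma polar_commV : invmx S *m theta = theta *m invmx S.
Proof.
exact: (comm_invmx polar_unit polar_comm).
Qed.

(** By commutation phi^2 = A^-1 theta^2 = A^-1 (eta xi - A), and A fixes eta. *)
Lemma polar_sqr : phi *m phi = - 1%:M + eta *m xi.
Proof.
have Su := polar_unit; have Au : A \in unitmx by rewrite -SS unitmx_mul Su.
rewrite /phi /polar_part -/eta -/A -/S {2}polar_commV.
have -> : invmx S *m theta *m (theta *m invmx S) =
    invmx S *m invmx S *m (theta *m theta).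
  by rewrite -mulmxA (mulmxA theta) -[in RHS]mulmxA; congr (_ *m _);
     rewrite -mulmxA -polar_commV mulmxA -polar_commV !mulmxA.
have -> : theta *m theta = eta *m xi - A by rewrite /A opprB addrC subrK.
have -> : invmx S *m invmx S = invmx A.
  by rewrite invmx_sqr // SS.
rewrite mulmxBr mulVmx// addrC; congr (_ + _); rewrite mulmxA; congr (_ *m _).
by rewrite -{1}Aeta mulKmx.
Qed.

Lemma polar_ker : xi *m phi = 0.
Proof. by rewrite /phi /polar_part -/eta -/A -/S polar_commV mulmxA (sk_ker sk) mul0mx. Qed.

Lemma polar_skew : phi *m g = - (g *m phi^T).
Proof.
have Su := polar_unit.
rewrite /phi /polar_part -/eta -/A -/S polar_commV.
have -> : theta *m invmx S *m g = theta *m g *m (invmx S)^T.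
  rewrite -!mulmxA; congr (_ *m _); apply: (can_inj (mulKmx Su)).
  by rewrite mulKVmx// mulmxA Sg -mulmxA -trmx_mul mulVmx// trmx1 mulmx1.
by rewrite (sk_skew sk) -polar_commV trmx_mul mulNmx mulmxA.
Qed.

Lemma polar_isometry : phi *m g *m phi^T = g - eta *m eta^T.
Proof.
have -> : phi *m g *m phi^T = - (phi *m phi *m g).
  by rewrite -(mulmxA phi phi) [in RHS]polar_skew mulmxN opprK (mulmxA phi).
rewrite polar_sqr mulmxDl mulNmx mul1mx opprD opprK; congr (_ - _).
by rewrite -mulmxA trmx_mul trmxK gt.
Qed.

End props.

Lemma skew_kernel_change g theta xi C : C \in unitmx -> skew_kernel g theta xi ->
  skew_kernel (C *m g *m C^T) (C *m theta *m invmx C) (xi *m invmx C).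
Proof.
move=> Cu [hg hs hk hu ho]; split.
- exact: posdef_congr.
- rewrite !trmx_mul !mulmxA mulmxKV// -(mulmxA C theta g) hs mulmxN mulNmx.
  rewrite -[in RHS](mulmxA _ C^T) -trmx_mul mulVmx// trmx1 mulmx1.
  by rewrite !mulmxA.
- by rewrite !mulmxA mulmxKV// hk mul0mx.
- rewrite trmx_mul -[C *m g *m C^T *m _]mulmxA (mulmxA C^T) -trmx_mul mulVmx//.
  by rewrite trmx1 mul1mx !mulmxA mulmxKV// -mulmxA.
- move=> v h; have [|a va] := ho (v *m C).
    move/(congr1 (mulmx^~ C)): h.
    by rewrite !mulmxA mulmxKV// mul0mx.
  by exists a; rewrite -[v](mulmxK Cu) va scalemxAl.
Qed.

Lemma polar_part_change g theta xi C : C \in unitmx -> skew_kernel g theta xi ->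
  polar_part (C *m g *m C^T) (C *m theta *m invmx C) (xi *m invmx C)
    = C *m polar_part g theta xi *m invmx C.
Proof.
move=> Cu sk; rewrite /polar_part.
have -> : C *m g *m C^T *m (xi *m invmx C)^T *m (xi *m invmx C) -
    C *m theta *m invmx C *m (C *m theta *m invmx C) =
    C *m (g *m xi^T *m xi - theta *m theta) *m invmx C.
  rewrite mulmxBr mulmxBl !mulmxA mulmxKV// trmx_mul; congr (_ - _).
  by rewrite !mulmxA -(mulmxA _ C^T) -trmx_mul mulVmx// trmx1 mulmx1.
rewrite gsqrt_change//; [|exact: sk_posdef sk|exact: polar_posdef sk].
set S := gsqrt _ _; have Su : S \in unitmx := polar_unit sk. clearbody S.
rewrite !mulmxA; congr (_ *m _ *m _).
have E : C *m S *m invmx C *m (C *m invmx S *m invmx C) = 1%:M.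
  by rewrite !mulmxA mulmxKV// mulmxK// mulmxV.
have Eu : C *m S *m invmx C \in unitmx by rewrite !unitmx_mul Cu Su unitmx_inv.
have -> : invmx (C *m S *m invmx C) = C *m invmx S *m invmx C.
  by apply: (can_inj (mulKmx Eu)); rewrite mulmxV.
by rewrite mulmxKV.
Qed.

Lemma skew_kernelN g theta xi : skew_kernel g theta xi -> skew_kernel g theta (- xi).
Proof.
move=> [hg hs hk hu ho]; split => //.
- by rewrite mulNmx hk oppr0.
- by rewrite linearN /= mulmxN mulmxN mulNmx opprK.
- by move=> v /ho[a ->]; exists (- a); rewrite scalerN scaleNr opprK.
Qed.

(** [xi] enters only through the projection [g *m xi^T *m xi]. *)
Lemma polar_partN g theta xi : polar_part g theta (- xi) = polar_part g theta xi.
Proof. by rewrite /polar_part [(- xi)^T]linearN /= !mulmxN mulNmx opprK. Qed.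

(* The kernel is a line, so that two unit vectors in it agree up to sign. *)
Lemma skew_kernel_unique g theta xi xi' : skew_kernel g theta xi ->
  skew_kernel g theta xi' -> xi' = xi \/ xi' = - xi.
Proof.
move=> sk sk'; have [a xia] := sk_only sk (sk_ker sk').
have := sk_unit sk'; rewrite xia linearZ /= -scalemxAr -scalemxAr -scalemxAl.
rewrite !mxE; have := sk_unit sk; rewrite mxE => -> /eqP.
rewrite mulr1 -expr2 sqrf_eq1 => /orP[]/eqP->; [left|right].
  by rewrite scale1r.
by rewrite scaleN1r.
Qed.

End Polar.

Section SkewKernelEx.
Context {R : realType} {n : nat}.

Lemma skew_kernel_ex (g theta : 'M[R]_(n + 1)) : posdef g ->
  theta *m g = - (g *m theta^T) -> \rank theta = n ->
  exists xi, skew_kernel g theta xi.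
Proof.
move=> hg hs rk.
have k1 : \rank (kermx theta) = 1%N by rewrite mxrank_ker rk addKn.
have [v vk v0] : exists2 v : 'rV_(n + 1), (v <= kermx theta)%MS & v != 0.
  by apply/rowV0Pn; rewrite -mxrank_eq0 k1.
have q0 := hg.2 v v0; set q := (v *m g *m v^T) 0 0 in q0.
pose c := (Num.sqrt q)^-1.
have c0 : c != 0 by rewrite invr_eq0 gt_eqF// sqrtr_gt0.
have qc : c * c * q = 1.
  by rewrite /c -invfM -expr2 sqr_sqrtr ?ltW// mulVf// gt_eqF.
exists (c *: v); split => //.
- by rewrite -scalemxAl (sub_kermxP vk) scaler0.
- rewrite linearZ /= -!scalemxAr -scalemxAl mulmxA !mxE.
  by rewrite mulrA -[RHS]qc /q mxE.
- move=> w /sub_kermxP wk.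
  have : (w <= v)%MS.
    apply: submx_trans wk _; rewrite -(geq_leqif (mxrank_leqif_sup vk)) k1.
    by rewrite lt0n mxrank_eq0.
  move=> /sub_rVP[a ->]; exists (a / c).
  by rewrite scalerA divfK.
Qed.

End SkewKernelEx.

(** * Tensor fields in charts *)

Lemma derive_comp (R : realType) (U V W : normedModType R) (f : U -> V)
    (g : V -> W) x v : differentiable f x -> differentiable g (f x) ->
  'D_v (g \o f) x = 'D_('D_v f x) g (f x).
Proof.
move=> df dg; rewrite deriveE; last exact: differentiable_comp.
by rewrite diff_comp// (deriveE _ df) (deriveE _ dg).
Qed.

Section Charts.
Context {R : realType} {N : nat} {M : manifold R N}.
Implicit Types (c d e : chart R N M) (p q : M) (X Y : M -> 'rV[R]_N)
  (theta g : M -> 'M[R]_N) (f : M -> R).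

Lemma chart_img_dom c x : chart_img c x ->
  chart_dom c (chart_inv c x) /\ chart_map c (chart_inv c x) = x.
Proof. by move=> [p cp <-]; rewrite chart_mapK. Qed.

Lemma chart_imgP c p : chart_dom c p -> chart_img c (chart_map c p).
Proof. by move=> cp; exists p. Qed.

Lemma chart_near c p (P : M -> Prop) : chart_dom c p -> (\forall q \near p, P q) ->
  \forall x \near chart_map c p, chart_img c x /\ P (chart_inv c x).
Proof.
move=> cp Pp; near=> x; split; near: x.
  apply: (@open_nbhs_nbhs _ _ (chart_img c)).
  by split; [exact: chart_img_open|exact: chart_imgP].
have := @chart_inv_cont _ _ _ c _ (chart_imgP cp) P.
by rewrite chart_mapK//; apply.
Unshelve. all: by end_near.
Qed.

Lemma chart_dom_near c p : chart_dom c p -> \forall q \near p, chart_dom c q.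
Proof.
move=> cp; apply: (@open_nbhs_nbhs _ _ (chart_dom c)).
by split; [exact: chart_dom_open|].
Qed.

Lemma chart_image_open c (U : set M) : open U ->
  open (chart_map c @` (chart_dom c `&` U)).
Proof.
move=> oU; rewrite openE => _ [p [cp Up] <-]; rewrite /interior.
have nU : \forall q \near p, U q by apply: open_nbhs_nbhs; split.
have := chart_near cp nU.
apply: filterS => x [xc Ux]; have [h1 h2] := chart_img_dom xc.
by exists (chart_inv c x).
Qed.

Lemma transition_smooth c d : atlas c -> atlas d ->
  smooth_on (chart_map c @` (chart_dom c `&` chart_dom d)) (transition c d).
Proof. by move=> ac ad; have [] := atlas_compatible ac ad. Qed.

Lemma transition_diff c d p : atlas c -> atlas d -> chart_dom c p ->
  chart_dom d p -> differentiable (transition c d) (chart_map c p).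
Proof.
move=> ac ad cp dp; have [h _] := transition_smooth ac ad 1%N.
by apply: h; exists p.
Qed.

Lemma transition_map c d p : chart_dom c p ->
  transition c d (chart_map c p) = chart_map d p.
Proof. by move=> cp; rewrite /transition /= chart_mapK. Qed.

Lemma derive_transition c d p v : atlas c -> atlas d -> chart_dom c p ->
  chart_dom d p ->
  'D_v (transition c d) (chart_map c p) = v *m change c d p.
Proof. by move=> ac ad cp dp; rewrite deriveEjacobian//; exact: transition_diff. Qed.

Lemma eq_mulmx_rV m k (A B : 'M[R]_(m, k)) :
  (forall v : 'rV_m, v *m A = v *m B) -> A = B.
Proof. by move=> h; apply/row_matrixP => i; rewrite !rowE h. Qed.

Lemma invmx_eq k (A B : 'M[R]_k) : A *m B = 1%:M -> invmx A = B.
Proof.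
move=> AB; have [Au _] := mulmx1_unit AB.
by rewrite -[LHS]mulmx1 -AB mulKmx.
Qed.

Lemma change_comp c d e p : atlas c -> atlas d -> atlas e ->
  chart_dom c p -> chart_dom d p -> chart_dom e p ->
  change c d p *m change d e p = change c e p.
Proof.
move=> ac ad ae cp dp ep; apply: eq_mulmx_rV => v; rewrite mulmxA.
rewrite -[LHS](derive_transition _ ad ae dp ep).
rewrite -[RHS](derive_transition _ ac ae cp ep).
have nE : \forall x \near chart_map c p,
    (transition d e \o transition c d) x = transition c e x.
  have := chart_near cp (chart_dom_near dp).
  apply: filterS => x [xc xd]; rewrite /transition /=.
  by rewrite chart_mapK.
rewrite -[RHS](near_eq_derive _ nE).
have dcd := transition_diff ac ad cp dp.
have dde := transition_diff ad ae dp ep.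
rewrite -(derive_transition _ ac ad cp dp) -(transition_map d cp) in dde *.
exact/esym/derive_comp.
Qed.

Lemma change_id c p : atlas c -> chart_dom c p -> change c c p = 1%:M.
Proof.
move=> ac cp; apply: eq_mulmx_rV => v; rewrite mulmx1.
rewrite -[LHS](derive_transition _ ac ac cp cp).
have E : \forall x \near chart_map c p, transition c c x = id x.
  have := chart_near cp (chart_dom_near cp).
  by apply: filterS => x [/chart_img_dom[_ h] _].
by rewrite (near_eq_derive _ E) derive_id.
Qed.

Lemma changeK c d p : atlas c -> atlas d -> chart_dom c p -> chart_dom d p ->
  change c d p *m change d c p = 1%:M.
Proof. by move=> ac ad cp dp; rewrite change_comp// change_id. Qed.

Lemma change_unit c d p : atlas c -> atlas d -> chart_dom c p -> chart_dom d p ->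
  change c d p \in unitmx.
Proof. by move=> ac ad cp dp; exact: (mulmx1_unit (changeK ac ad cp dp)).1. Qed.

Lemma change_inv c d p : atlas c -> atlas d -> chart_dom c p -> chart_dom d p ->
  invmx (change c d p) = change d c p.
Proof.
by move=> ac ad cp dp; exact: (invmx_eq (changeK ac ad cp dp)).
Qed.

Lemma smooth_change c d : atlas c -> atlas d ->
  smooth_on (chart_map c @` (chart_dom c `&` chart_dom d))
    (change c d \o chart_inv c).
Proof.
move=> ac ad k; have oU := @chart_image_open c _ (chart_dom_open d).
apply/Cn_on_mxP => // i j.
apply: (@Cn_on_eq _ _ _ _ _ (fun x => ('D_(delta_mx 0 i) (transition c d) x) 0 j)) => //.
  move=> x; rewrite inE => -[p [cp dp] <-] /=.
  by rewrite (derive_transition _ ac ad cp dp) (chart_mapK cp) -rowE mxE.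
apply: Cn_on_entry => //.
by have [_] := transition_smooth ac ad k.+1; exact.
Qed.

Lemma smooth_on_diff (V W : normedModType R) (U : set V) (f : V -> W) x :
  smooth_on U f -> U x -> differentiable f x.
Proof. by move=> /(_ 1%N)[h _]; exact: h. Qed.

Section change_components.
Variables (c d : chart R N M) (p : M).
Hypotheses (ac : atlas c) (ad : atlas d) (cp : chart_dom c p) (dp : chart_dom d p).
Let ap := chart_at_atlas p.
Let pp := chart_at_dom p.

Lemma vector_in_change X : vector_in d X p = vector_in c X p *m change c d p.
Proof. by rewrite /vector_in -mulmxA (change_comp ap ac ad pp cp dp). Qed.

Lemma endo_in_change theta :
  endo_in d theta p = change d c p *m endo_in c theta p *m change c d p.
Proof.
rewrite /endo_in; move: (change_comp ad ac ap dp cp pp) (change_comp ap ac ad pp cp dp).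
generalize (change d c p) (change c (chart_at p) p) (change d (chart_at p) p).
generalize (change c d p) (change (chart_at p) c p) (change (chart_at p) d p).
by move=> ? ? _ ? ? _ <- <-; rewrite !mulmxA.
Qed.

Lemma bilin_in_change g :
  bilin_in d g p = change d c p *m bilin_in c g p *m (change d c p)^T.
Proof.
rewrite /bilin_in; move: (change_comp ad ac ap dp cp pp).
generalize (change d c p) (change c (chart_at p) p) (change d (chart_at p) p).
by move=> ? ? _ <-; rewrite trmx_mul !mulmxA.
Qed.

End change_components.

Lemma vector_in_at X p : vector_in (chart_at p) X p = X p.
Proof.
by rewrite /vector_in (change_id (chart_at_atlas p) (chart_at_dom p)) mulmx1.
Qed.

Section algebra_in_chart.
Variables (c : chart R N M) (p : M).
Hypotheses (ac : atlas c) (cp : chart_dom c p).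
Let ap := chart_at_atlas p.
Let pp := chart_at_dom p.

Lemma endo_field_in theta X :
  vector_in c (endo_field theta X) p = vector_in c X p *m endo_in c theta p.
Proof.
rewrite /vector_in /endo_in /endo_field /endo_app; move: (changeK ap ac pp cp).
generalize (change c (chart_at p) p) (change (chart_at p) c p) => A B BA.
by rewrite -!mulmxA (mulmxA B) BA mul1mx.
Qed.

Lemma bilin_fields_in g X Y : bilin_fields g X Y p =
  (vector_in c X p *m bilin_in c g p *m (vector_in c Y p)^T) 0 0.
Proof.
rewrite /bilin_fields /bilin_app /vector_in /bilin_in; move: (changeK ap ac pp cp).
generalize (change c (chart_at p) p) (change (chart_at p) c p) => A B BA.
have AB : A^T *m B^T = 1%:M by rewrite -trmx_mul BA trmx1.
by rewrite trmx_mul -!mulmxA (mulmxA A^T) AB mul1mx (mulmxA B A) BA mul1mx.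
Qed.

End algebra_in_chart.

Lemma smooth_endo_field theta X : smooth_endo theta -> smooth_vector_field X ->
  smooth_vector_field (endo_field theta X).
Proof.
move=> st sX c ac k; have oc : open (chart_img c) := chart_img_open (c:=c).
apply: (@Cn_on_eq _ _ _ _ _
  (fun x => vector_in c X (chart_inv c x) *m endo_in c theta (chart_inv c x))) => //.
  move=> x; rewrite inE => /chart_img_dom[h _].
  by rewrite /= endo_field_in.
by apply: Cn_on_mulmx => //; [exact: sX|exact: st].
Qed.

Lemma smooth_vectorD X Y : smooth_vector_field X -> smooth_vector_field Y ->
  smooth_vector_field (fun p => X p + Y p).
Proof.
move=> sX sY c ac k; have oc : open (chart_img c) := chart_img_open (c:=c).
rewrite (_ : _ \o _ = (vector_in c X \o chart_inv c) + (vector_in c Y \o chart_inv c)).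
  by apply: Cn_onD => //; [exact: sX|exact: sY].
by apply/funext => x; rewrite /= /vector_in mulmxDl.
Qed.

Lemma smooth_vectorZ f X : smooth_function f -> smooth_vector_field X ->
  smooth_vector_field (fun p => f p *: X p).
Proof.
move=> sf sX c ac k; have oc : open (chart_img c) := chart_img_open (c:=c).
rewrite (_ : _ \o _ = fun x => (f \o chart_inv c) x *: (vector_in c X \o chart_inv c) x).
  by apply: Cn_on_mxZ => //; [exact: sf|exact: sX].
by apply/funext => x; rewrite /= /vector_in scalemxAl.
Qed.

Lemma smooth_vectorZc a X : smooth_vector_field X ->
  smooth_vector_field (fun p => a *: X p).
Proof.
by move=> sX; apply: (@smooth_vectorZ (fun=> a)) => // c ac k; exact: Cn_on_cst.
Qed.

End Charts.

(** * From a skew-symmetric endomorphism to an almost contact structure *)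

Section LocalKernel.
Context {R : realType} {V : normedModType R} {N : nat}.
Implicit Types (U : set V) (G T : V -> 'M[R]_N) (w : V -> 'rV[R]_N).

Lemma open_preimage U (f : V -> R) (D : set R) : open U -> open D ->
  (forall x, U x -> {for x, continuous f}) -> open (U `&` f @^-1` D).
Proof.
move=> oU oD cf; rewrite openE => x [Ux Dx]; rewrite /interior.
apply: filterI; first exact: open_nbhs_nbhs.
by apply: (cf x Ux); exact: open_nbhs_nbhs.
Qed.

Lemma smooth_polar U G T w : open U ->
  (forall x, U x -> skew_kernel (G x) (T x) (w x)) ->
  smooth_on U G -> smooth_on U T -> smooth_on U w ->
  smooth_on U (fun x => polar_part (G x) (T x) (w x)).
Proof.
move=> oU sk cG cT cw k.
pose A x := G x *m (w x)^T *m w x - T x *m T x.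
have cA : Cn_on k U A.
  apply: Cn_on_mxB => //; last exact: Cn_on_mulmx.
  by do 2 apply: Cn_on_mulmx => //; exact: Cn_on_trmx.
have pG x : U x -> posdef (G x) by move=> /sk[].
pose H x := sqrtmx (G x).
have cH : Cn_on k U H.
  by apply: Cn_on_sqrtmx => // x; rewrite inE; exact: pG.
have Hu x : U x -> H x \in unitmx by move=> /pG/sqrtmxP[/posdef_unit].
have cHV : Cn_on k U (fun x => invmx (H x)).
  by apply: Cn_on_invmx => // x; rewrite inE; exact: Hu.
apply: Cn_on_mulmx => //; apply: Cn_on_invmx => //.
  by move=> x; rewrite inE => /sk; exact: polar_unit.
apply: Cn_on_mulmx => //; apply: Cn_on_mulmx => //; apply: Cn_on_sqrtmx => //.
  move=> x; rewrite inE => Ux; apply: posdef_conj; first exact: pG.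
  exact: polar_posdef (sk _ Ux).
by do 2 apply: Cn_on_mulmx => //.
Qed.

(* The kernel of T(x) is spanned by w0 (T(x) + eta0 w0)^-1, where w0 spans the
   kernel at x0 and eta0 is its dual form: if k T(x) = 0 then
   k (T(x) + eta0 w0) is a multiple of w0. *)
Lemma local_kernel U G T w x0 : open U -> U x0 ->
  (forall x, U x -> skew_kernel (G x) (T x) (w x)) ->
  smooth_on U G -> smooth_on U T ->
  exists U' w', [/\ open U', U' x0, U' `<=` U, smooth_on U' w' &
    w' x0 = w x0 /\ forall x, U' x -> skew_kernel (G x) (T x) (w' x)].
Proof.
move=> oU Ux0 sk cG cT.
pose w0 := w x0; pose eta0 := G x0 *m w0^T; pose B x : 'M[R]_N := T x + eta0 *m w0.
have cB k : Cn_on k U B by apply: Cn_onD => //; exact: Cn_on_cst.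
have sk0 := sk _ Ux0.
have w0eta : w0 *m eta0 = 1%:M by rewrite [LHS]mx11_scalar (sk_unit sk0).
have Bx0 : \det (B x0) != 0.
  rewrite -unitfE -unitmxE -row_free_unit; apply: row_free_ker0 => v.
  rewrite /B mulmxDr => h.
  have Teta : T x0 *m eta0 = 0.
    rewrite /eta0 mulmxA (sk_skew sk0) mulNmx -mulmxA -trmx_mul (sk_ker sk0).
    by rewrite trmx0 mulmx0 oppr0.
  have veta : v *m eta0 = 0.
    have := congr1 (mulmx^~ eta0) h; rewrite mul0mx mulmxDl -mulmxA Teta mulmx0.
    by rewrite add0r -!mulmxA w0eta mulmx1.
  move: h; rewrite (mulmxA v) veta mul0mx addr0 => /(sk_only sk0)[a va].
  move: veta; rewrite va -scalemxAl w0eta => /matrixP/(_ 0 0).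
  by rewrite !mxE mulr1 => ->; rewrite scale0r.
pose U' := U `&` (fun x => \det (B x)) @^-1` [set y | y != 0].
have oU' : open U'.
  apply: open_preimage => //; last exact: (Cn_on_det oU (cB 0%N)).
have U'U : U' `<=` U by move=> x [].
have Bu x : U' x -> B x \in unitmx by move=> [_ h]; rewrite unitmxE unitfE.
pose v x := w0 *m invmx (B x).
have cv k : Cn_on k U' v.
  apply: Cn_on_mulmx => //; first exact: Cn_on_cst.
  apply: Cn_on_invmx => //; last exact: Cn_on_sub (cB k).
  by move=> x; rewrite inE; exact: Bu.
have vE x : U' x -> exists2 a, v x = a *: w x & a != 0.
  move=> U'x; have skx := sk _ (U'U _ U'x).
  have wB : w x *m B x = (w x *m eta0) *m w0.
    by rewrite /B mulmxDr (sk_ker skx) add0r mulmxA.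
  have {}wB : w x = (w x *m eta0) 0 0 *: v x.
    rewrite /v scalemxAl -mul_scalar_mx -mx11_scalar -wB mulmxK//.
    exact: Bu.
  have w0x : w x != 0.
    apply/eqP => w0x; have := sk_unit skx; rewrite w0x mul0mx mxE => /esym/eqP.
    by rewrite oner_eq0.
  set b := (w x *m eta0) 0 0 in wB.
  have b0 : b != 0 by apply: contra w0x => /eqP b0; rewrite wB b0 scale0r.
  exists b^-1; last by rewrite invr_eq0.
  by rewrite wB scalerA mulVf// scale1r.
have v0 x : U' x -> v x != 0.
  move=> U'x; apply/eqP => vx; have := congr1 (mulmx^~ (B x)) vx.
  rewrite /= /v mulmxKV ?Bu// mul0mx => w00.
  have := sk_unit sk0; rewrite -/w0 w00 mul0mx mxE => /esym/eqP.
  by rewrite oner_eq0.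
(* The squared norm is kept as a 1x1 matrix, so that [Cn_on_sqrtmx] also yields the smoothness of
   the norm. *)
pose Q x := v x *m G x *m (v x)^T.
have pQ x : U' x -> posdef (Q x).
  move=> U'x; have hG := sk_posdef (sk _ (U'U _ U'x)).
  have q0 := hG.2 _ (v0 _ U'x); split.
    by rewrite /Q (trmx_mul (v x *m G x)) (trmx_mul (v x) (G x)) trmxK hG.1 mulmxA.
  move=> a a0; rewrite [a]mx11_scalar; set b := a 0 0.
  rewrite tr_scalar_mx mul_scalar_mx mul_mx_scalar scalerA -expr2.
  rewrite [ltRHS]mxE pmulr_rgt0// lt_neqAle sqr_ge0 andbT eq_sym sqrf_eq0.
  by apply: contra a0 => /eqP b0; rewrite [a]mx11_scalar -/b b0 raddf0.
pose s x := sqrtmx (Q x).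
pose w1 x := invmx (s x) *m v x.
have cw1 k : Cn_on k U' w1.
  apply: Cn_on_mulmx => //; apply: Cn_on_invmx => //.
    by move=> x; rewrite inE => /pQ/sqrtmxP[/posdef_unit].
  apply: Cn_on_sqrtmx => // [x|]; first by rewrite inE; exact: pQ.
  apply: Cn_on_mulmx => //; last exact: Cn_on_trmx.
  by apply: Cn_on_mulmx => //; exact: Cn_on_sub (cG k).
have sk1 x : U' x -> skew_kernel (G x) (T x) (w1 x).
  move=> U'x; have skx := sk _ (U'U _ U'x).
  have [hs ss] := sqrtmxP (pQ _ U'x); have su := posdef_unit hs.
  have [a va a0] := vE _ U'x.
  pose b := (invmx (s x)) 0 0.
  have w1E : w1 x = b *: v x.
    by rewrite /w1 (mx11_scalar (invmx _)) mul_scalar_mx.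
  have b0 : b != 0.
    apply/eqP => b0; have := mulVmx su; rewrite -/(s x) (mx11_scalar (invmx _)) -/b b0.
    by rewrite mul_scalar_mx scale0r => /matrixP/(_ 0 0)/eqP; rewrite !mxE eq_sym oner_eq0.
  split; [exact: sk_posdef skx|exact: sk_skew skx|..].
  - by rewrite w1E va scalerA -scalemxAl (sk_ker skx) scaler0.
  - have E (a' : 'M[R]_1) (z : 'rV[R]_N) : a' *m z *m (G x *m (a' *m z)^T) =
        a' *m (z *m G x *m z^T) *m a'^T by rewrite trmx_mul !mulmxA.
    rewrite /w1 E -/(Q x) trmx_inv; move: hs ss su; rewrite -/(s x).
    move: (s x) (Q x) => S _ [St _] <- Su.
    by rewrite St mulmxA mulVmx// mul1mx mulmxV// mxE.
  - move=> z /(sk_only skx)[t ->]; exists (t / (b * a)).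
    by rewrite w1E va !scalerA -(mulrA _ b a) divfK// mulf_neq0.
have U'x0 : U' x0 by split.
(* Normalization leaves a sign, chosen so as to agree with [w] at [x0]. *)
case: (skew_kernel_unique sk0 (sk1 _ U'x0)) => E.
  by exists U', w1; split.
exists U', (fun x => - w1 x); split => //.
  by move=> k; exact: Cn_on_mxN.
split; first by rewrite E opprK.
by move=> x U'x; apply: skew_kernelN; exact: sk1.
Qed.

End LocalKernel.

Section BilinExt.
Context {R : realType} {N : nat}.

Lemma bilin_ext (A B : 'M[R]_N) :
  (forall u v : 'rV_N, (u *m A *m v^T) 0 0 = (u *m B *m v^T) 0 0) -> A = B.
Proof.
move=> h; apply/matrixP => i j; have := h (delta_mx 0 i) (delta_mx 0 j).
by rewrite -!rowE !trmx_delta -!colE !mxE.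
Qed.

Lemma riemannian_posdef (M : manifold R N) (g : M -> 'M[R]_N) p :
  riemannian_metric g -> posdef (g p).
Proof.
move=> [_ gs gp]; split; last exact: gp.
apply: bilin_ext => u v; rewrite -[RHS]gs /bilin_app.
by rewrite -[in LHS](trmxK u) -trmx_mul -trmx_mul mxE mulmxA.
Qed.

End BilinExt.

(** * The oriented unit field spanning the kernel *)

Section KernelToContact.
Context {R : realType} {n : nat}.
Local Notation N := (n + n + 1)%N.
Context {M : manifold R N}.
Variables (g theta : M -> 'M[R]_N) (O : set (chart R N M)).
Hypotheses (rg : riemannian_metric g) (st : smooth_endo theta)
  (skew : skew_symmetric g theta) (rk : constant_rank theta (n + n)).
Hypotheses (O_atlas : O `<=` @atlas R N M)
  (O_cover : forall p : M, exists2 c, O c & chart_dom c p)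
  (O_det : forall c d p, O c -> O d -> chart_dom c p -> chart_dom d p ->
     0 < \det (change c d p)).

(** [chart_at p] need not belong to [O], so that positivity is tested after transport to the charts
    of [O]. *)
Definition oriented_kernel (p : M) (x : 'rV[R]_N) : Prop :=
  skew_kernel (g p) (theta p) x /\
  forall d, O d -> chart_dom d p -> positive_kernel
    (change d (chart_at p) p *m polar_part (g p) (theta p) x *m change (chart_at p) d p)
    (x *m change (chart_at p) d p).

Lemma skew_kernel_at p : exists x, skew_kernel (g p) (theta p) x.
Proof.
apply: skew_kernel_ex; [exact: riemannian_posdef|..|exact: rk].
apply: bilin_ext => u v; have := skew p u v; rewrite /bilin_app /endo_app.
rewrite trmx_mul !mulmxA => ->.
by rewrite mulmxN mulNmx !mxE !mulmxA.
Qed.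

Lemma oriented_kernel_ex p : exists x, oriented_kernel p x.
Proof.
have [x0 sk0] := skew_kernel_at p.
have [d0 Od0 d0p] := O_cover p.
have ap := chart_at_atlas p; have pp := chart_at_dom p.
have [x skx posx] : exists2 x, skew_kernel (g p) (theta p) x &
    positive_kernel (change d0 (chart_at p) p *m polar_part (g p) (theta p) x
      *m change (chart_at p) d0 p) (x *m change (chart_at p) d0 p).
  move: (change_unit (O_atlas Od0) ap d0p pp) (change_inv (O_atlas Od0) ap d0p pp).
  generalize (change d0 (chart_at p) p) (change (chart_at p) d0 p) => C D Cu <- {D}.
  have sk1 := skew_kernel_change Cu sk0; have pE := polar_part_change Cu sk0.
  have sq := polar_sqr sk1; have ke := polar_ker sk1; rewrite pE in sq ke.
  case: (positive_kernel_or ke (sk_unit sk1) sq) => h.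
    by exists x0.
  exists (- x0); first exact: skew_kernelN.
  by rewrite polar_partN mulNmx.
(* The sign was fixed in the single chart [d0]; positive transition determinants carry it to every
   chart of [O] around p. *)
exists x; split; [exact: skx|move=> d Od dp].
have := positive_kernel_change (O_det Od Od0 dp d0p) posx.
rewrite (change_inv (O_atlas Od) (O_atlas Od0) dp d0p).
move: (change_comp (O_atlas Od) (O_atlas Od0) ap dp d0p pp).
move: (change_comp ap (O_atlas Od0) (O_atlas Od) pp d0p dp).
generalize (change (chart_at p) d p) (change d (chart_at p) p).
generalize (change d0 d p) (change (chart_at p) d0 p) (change d d0 p)
  (change d0 (chart_at p) p).
by move=> A B C D _ _ <- <-; rewrite !mulmxA.
Qed.

Definition contact_xi (p : M) : 'rV[R]_N := get (oriented_kernel p).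
Definition contact_eta (p : M) : 'cV[R]_N := g p *m (contact_xi p)^T.
Definition contact_phi (p : M) : 'M[R]_N :=
  polar_part (g p) (theta p) (contact_xi p).

Local Notation xi := contact_xi.
Local Notation phi := contact_phi.

Lemma xiP p : oriented_kernel p (xi p).
Proof. exact: (getPex (oriented_kernel_ex p)). Qed.

Section in_chart.
Variables (c : chart R N M) (p : M).
Hypotheses (ac : @atlas R N M c) (cp : chart_dom c p).
Let ap := chart_at_atlas p.
Let pp := chart_at_dom p.

Lemma skew_kernel_in :
  skew_kernel (bilin_in c g p) (endo_in c theta p) (vector_in c xi p).
Proof.
have := (xiP p).1; rewrite /bilin_in /endo_in /vector_in.
move: (change_unit ac ap cp pp) (change_inv ac ap cp pp).
generalize (change c (chart_at p) p) (change (chart_at p) c p) => C D Cu <-.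
exact: skew_kernel_change.
Qed.

Lemma phi_in : endo_in c phi p =
  polar_part (bilin_in c g p) (endo_in c theta p) (vector_in c xi p).
Proof.
have := (xiP p).1; rewrite /phi /bilin_in /endo_in /vector_in.
move: (change_unit ac ap cp pp) (change_inv ac ap cp pp).
generalize (change c (chart_at p) p) (change (chart_at p) c p) => C D Cu <- h.
by rewrite polar_part_change.
Qed.

Lemma eta_in : form_in c contact_eta p = bilin_in c g p *m (vector_in c xi p)^T.
Proof.
rewrite /contact_eta /bilin_in /form_in /vector_in.
move: (changeK ap ac pp cp).
generalize (change c (chart_at p) p) (change (chart_at p) c p) => C D DC.
by rewrite trmx_mul !mulmxA -(mulmxA _ C^T) -trmx_mul DC trmx1 mulmx1.
Qed.

End in_chart.

Lemma oriented_in d p : O d -> chart_dom d p ->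
  positive_kernel (endo_in d phi p) (vector_in d xi p).
Proof. by move=> Od dp; exact: (xiP p).2. Qed.

(* Near each point the kernel is spanned by a smooth unit vector w, so that
   xi = w or xi = - w; the sign is that of a nonvanishing continuous function,
   the determinant of a frame adapted to (phi, w). *)
Lemma xi_locally (c : chart R N M) x0 : atlas c -> chart_img c x0 ->
  exists U w, [/\ open U, U x0, U `<=` chart_img c, smooth_on U w &
    forall x, U x -> w x = vector_in c xi (chart_inv c x)].
Proof.
move=> ac cx0.
have oc : open (chart_img c) := chart_img_open (c := c).
have skc x : chart_img c x -> skew_kernel (bilin_in c g (chart_inv c x))
    (endo_in c theta (chart_inv c x)) (vector_in c xi (chart_inv c x)).
  by move=> /chart_img_dom[h _]; exact: skew_kernel_in.
have [sg _ _] := rg.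
have [U [w [oU Ux0 Uc sw [w0 skw]]]] :=
  local_kernel (w := vector_in c xi \o chart_inv c) oc cx0 skc (sg c ac) (st ac).
pose Phi x := polar_part (bilin_in c g (chart_inv c x))
    (endo_in c theta (chart_inv c x)) (w x).
have sPhi : smooth_on U Phi.
  apply: smooth_polar => // k; apply: Cn_on_sub Uc _; [exact: sg|exact: st].
have PhiE x : U x -> Phi x = endo_in c phi (chart_inv c x).
  move=> Ux; have [cx _] := chart_img_dom (Uc _ Ux).
  rewrite /Phi (phi_in ac cx).
  case: (skew_kernel_unique (skc _ (Uc _ Ux)) (skw _ Ux)) => ->.
    exact: erefl.
  exact: polar_partN.
have wPhi x : U x -> w x *m Phi x = 0 by move=> Ux; exact: polar_ker (skw _ Ux).
have ppp x : U x -> Phi x *m Phi x *m Phi x = - Phi x.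
  move=> Ux; have sq := polar_sqr (skw _ Ux).
  rewrite -/(Phi x) in sq.
  by rewrite sq mulmxDl mulNmx mul1mx -mulmxA (wPhi _ Ux) mulmx0 addr0.
clearbody Phi.
have [p0c mp0] := chart_img_dom cx0; set p0 := chart_inv c x0 in p0c mp0.
have [d Od dp0] := O_cover p0; have ad := O_atlas Od.
pose W := chart_map c @` (chart_dom c `&` chart_dom d).
have oW : open W by apply: chart_image_open; exact: chart_dom_open.
have Wx0 : W x0 by exists p0.
have sC := smooth_change ac ad; rewrite -/W in sC.
have [v vpp dv] := oriented_in Od dp0.
pose UW := U `&` W.
have oUW : open UW by exact: openI.
pose v' := v *m change d c p0.
(* The constant rows [v'] satisfy v' Phi^2 = - v' at [x0] only; - Phi(x)^2 projects them to rows
   with this property at every x, without moving them at [x0]. The second factor passes to the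
   oriented chart [d]. *)
pose h x := \det (frame (Phi x) (w x) (- (v' *m Phi x *m Phi x))) *
  \det (change c d (chart_inv c x)).
have ch k : Cn_on k UW h.
  apply: Cn_onM => //; apply: Cn_on_det => //; last first.
    by apply: Cn_on_sub (sC k) => x [].
  have cP : Cn_on k UW Phi by apply: Cn_on_sub (sPhi k) => x [].
  have cw : Cn_on k UW w by apply: Cn_on_sub (sw k) => x [].
  have cv : Cn_on k UW (fun x => - (v' *m Phi x *m Phi x)).
    apply: Cn_on_mxN => //; do 2 apply: Cn_on_mulmx => //.
    exact: Cn_on_cst.
  have col_Cn a b (f1 : 'rV[R]_N -> 'M[R]_(a, N)) (f2 : 'rV[R]_N -> 'M[R]_(b, N)) :
      Cn_on k UW f1 -> Cn_on k UW f2 -> Cn_on k UW (fun x => col_mx (f1 x) (f2 x)).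
    move=> c1 c2; apply/Cn_on_mxP => // i j; under eq_fun do rewrite mxE.
    by case: (fintype.split i) => i'; exact: Cn_on_entry.
  exact: (col_Cn _ _ _ _ (col_Cn _ _ _ _ cv (Cn_on_mulmx oUW cv cP)) cw).
have Dframe x z e : W x -> frame (Phi x) e z *m change c d (chart_inv c x) =
    frame (change d c (chart_inv c x) *m Phi x *m change c d (chart_inv c x))
      (e *m change c d (chart_inv c x)) (z *m change c d (chart_inv c x)).
  move=> [q [cq dq] <-]; rewrite chart_mapK//.
  move: (changeK ac ad cq dq).
  generalize (change c d q) (change d c q) => A B AB.
  by rewrite /frame !mul_col_mx !mulmxA -(mulmxA z A) AB mulmx1.
have PhiD x : U x -> W x ->
    change d c (chart_inv c x) *m Phi x *m change c d (chart_inv c x)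
    = endo_in d phi (chart_inv c x).
  move=> Ux; rewrite (PhiE _ Ux) => -[q [cq dq] <-]; rewrite (chart_mapK cq).
  exact: (esym (endo_in_change ac ad cq dq phi)).
have vxpp x : U x -> - (v' *m Phi x *m Phi x) *m Phi x *m Phi x =
    - - (v' *m Phi x *m Phi x).
  move=> Ux; have := congr1 (fun Z => v' *m Z *m Phi x) (ppp _ Ux).
  by rewrite !mulmxA mulmxN mulNmx => e; rewrite !mulNmx e.
have hx0 : 0 < h x0.
  rewrite /h -det_mulmx (Dframe _ _ _ Wx0) (PhiD _ Ux0 Wx0) w0.
  have -> : - (v' *m Phi x0 *m Phi x0) *m change c d (chart_inv c x0) = v.
    move: vpp; rewrite -(PhiD _ Ux0 Wx0) -/p0.
    move: (changeK ad ac dp0 p0c) (changeK ac ad p0c dp0); rewrite /v'.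
    generalize (change d c p0) (change c d p0) (Phi x0) => A B F AB BA.
    rewrite !mulmxA -(mulmxA _ B A) BA mulmx1 => vE.
    by rewrite mulNmx vE opprK.
  have E1 := esym (vector_in_change ac ad p0c dp0 xi).
  by rewrite /= E1.
pose U' := UW `&` h @^-1` [set y | 0 < y].
have oU' : open U'.
  by apply: open_preimage => //; exact: (ch 0%N).
exists U', w; split; first exact: oU'.
- by split; [split|exact: hx0].
- by move=> x [[/Uc]].
- by move=> k; apply: Cn_on_sub (sw k) => x [[]].
move=> x [[Ux Wx] /= hx].
case: (skew_kernel_unique (skc _ (Uc _ Ux)) (skw _ Ux)) => [wE|wE]; first exact: wE.
(* Here w = - xi, and h > 0 makes w positive in the chart [d], where xi = - w is positive by
   construction. *)
exfalso.
case: (Wx) => q [cq dq] qx; have qE : chart_inv c x = q by rewrite -qx (chart_mapK cq).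
rewrite qE in wE.
have PD := PhiD _ Ux Wx; rewrite qE in PD.
have posw : positive_kernel (endo_in d phi q) (w x *m change c d q).
  rewrite -PD; exists (- (v' *m Phi x *m Phi x) *m change c d q); last first.
    by rewrite -{1 2 3 4}qE -(Dframe _ _ _ Wx) det_mulmx; exact: hx.
  move: (changeK ac ad cq dq) (vxpp _ Ux).
  generalize (- (v' *m Phi x *m Phi x)).
  generalize (change c d q) (change d c q) (Phi x) => A B F z AB zE.
  by rewrite !mulmxA -(mulmxA z A B) AB mulmx1 -(mulmxA _ A B) AB mulmx1 zE mulNmx.
have E2 : vector_in d xi q = - (w x *m change c d q).
  rewrite wE mulNmx opprK; exact: (vector_in_change ac ad cq dq xi).
have posd := oriented_in Od dq; rewrite E2 in posd.
refine (positive_kernel_opp _ posw posd).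
rewrite -PD; move: (changeK ac ad cq dq) (wPhi _ Ux).
generalize (change c d q) (change d c q) (Phi x) (w x) => A B F e AB eF.
by rewrite !mulmxA -(mulmxA e A B) AB mulmx1 eF mul0mx.
Qed.

Lemma contact_structure :
  exists theta' xi' eta', almost_contact_metric theta' xi' eta' g.
Proof.
have [sg _ _] := rg.
have sxi : smooth_vector_field xi.
  move=> c ac k; apply: Cn_on_local => x0 /(xi_locally ac)[U [w [oU Ux0 _ sw wE]]].
  exists U => //; apply: Cn_on_eq (sw k) => // x; rewrite inE => Ux.
  exact: wE.
exists phi, xi, contact_eta; split.
- split => //.
  + move=> c ac k; have oc : open (chart_img c) := chart_img_open (c := c).
    apply: (@Cn_on_eq _ _ _ _ _ (fun x => polar_part (bilin_in c g (chart_inv c x))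
      (endo_in c theta (chart_inv c x)) (vector_in c xi (chart_inv c x)))) => //.
      by move=> x; rewrite inE => /chart_img_dom[h _]; rewrite -phi_in.
    apply: smooth_polar => //; [|exact: sg|exact: st|exact: sxi].
    by move=> x /chart_img_dom[h _]; exact: skew_kernel_in.
  + move=> c ac k; have oc : open (chart_img c) := chart_img_open (c := c).
    apply: (@Cn_on_eq _ _ _ _ _ (fun x => bilin_in c g (chart_inv c x)
      *m (vector_in c xi (chart_inv c x))^T)) => //.
      by move=> x; rewrite inE => /chart_img_dom[h _]; rewrite /= eta_in.
    apply: Cn_on_mulmx => //; first exact: sg.
    by apply: Cn_on_trmx => //; exact: sxi.
- by move=> p; exact: (sk_unit (xiP p).1).
- move=> p v; rewrite /endo_app -mulmxA (polar_sqr (xiP p).1) mulmxDr mulmxN mulmx1.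
  congr (_ + _); rewrite mulmxA [v *m _]mx11_scalar mul_scalar_mx.
  by [].
- move=> p u v; rewrite /bilin_app /endo_app /one_form_app.
  have := polar_isometry (xiP p).1; rewrite -/(phi p) -/(contact_eta p) => E.
  move: E; generalize (phi p) (contact_eta p) (g p) => F e G E.
  have -> : u *m F *m G *m (v *m F)^T = u *m (F *m G *m F^T) *m v^T.
    by rewrite trmx_mul !mulmxA.
  rewrite E mulmxBr mulmxBl mxE; congr (_ + _); rewrite mxE; congr (- _).
  rewrite (mulmxA u) -(mulmxA (u *m e)) -trmx_mul mxE big_ord1.
  by rewrite [X in _ * X]mxE.
Qed.

End KernelToContact.

(** * The Levi-Civita connection *)

Section Schwarz.
Context {R : realType} {V : normedModType R}.

Lemma is_derive_line (f : V -> R) (x u : V) (t : R) :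
  differentiable f (x + t *: u) ->
  is_derive t 1 (fun t : R => f (x + t *: u)) ('D_u f (x + t *: u)).
Proof.
move=> df.
have lE : (fun t : R => x + t *: u) = cst x + (fun t : R => id t *: u) by [].
have did : differentiable (id : R -> R) t by [].
have dZ := differentiableZl u did.
have dl' : differentiable (fun t : R => x + t *: u) t.
  by rewrite lE; exact: (differentiableD (differentiable_cst x t) dZ).
have dlE : 'D_1 (fun t : R => x + t *: u) t = u.
  rewrite (deriveE _ dl') lE (diffD (differentiable_cst x t) dZ) diff_cst.
  rewrite (diffZl u did) /= add0r.
  by rewrite -(deriveE _ did) derive_id scale1r.
have dc : differentiable (f \o (fun t : R => x + t *: u)) t.
  exact: differentiable_comp.
apply: DeriveDef; first exact: diff_derivable.
by rewrite (deriveE _ dc) (diff_comp dl' df) /= -(deriveE _ dl') dlE (deriveE _ df).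
Qed.

(* The second difference of f along u and v is evaluated with the mean value
   theorem, first in the direction u and then in the direction v. *)
Lemma second_difference (U : set V) (f : V -> R) (x u v : V) (s : R) :
  Cn_on 2 U f -> 0 < s ->
  (forall a b, 0 <= a <= s -> 0 <= b <= s -> U (x + a *: u + b *: v)) ->
  exists a b, [/\ 0 <= a <= s, 0 <= b <= s &
    f (x + s *: u + s *: v) - f (x + s *: u) - (f (x + s *: v) - f x)
      = s * s * 'D_v ('D_u f) (x + a *: u + b *: v)].
Proof.
move=> [df c1] s0 hU; have [ddf _] := c1 u.
have s00 : 0 <= (0 : R) <= s by rewrite lexx ltW.
have dfa a b : 0 <= a <= s -> 0 <= b <= s -> differentiable f (x + b *: v + a *: u).
  by move=> ha hb; apply: df; rewrite addrAC; exact: hU.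
pose phi a := f (x + s *: v + a *: u) - f (x + a *: u).
pose dphi a := 'D_u f (x + s *: v + a *: u) - 'D_u f (x + a *: u).
have ss : 0 <= s <= s by rewrite lexx ltW.
have dphiP a : 0 <= a <= s -> is_derive a 1 phi (dphi a).
  move=> ha.
  have h1 := is_derive_line (dfa a s ha ss).
  have h2 : is_derive a 1 (fun t : R => f (x + t *: u)) ('D_u f (x + a *: u)).
    apply: is_derive_line; have := dfa a 0 ha s00.
    by rewrite scale0r addr0.
  exact: is_deriveB.
have [a ha Ea] : exists2 a, a \in `]0, s[ & phi s - phi 0 = dphi a * (s - 0).
  apply: (@MVT R phi dphi 0 s s0) => [a /itvP ha|].
    by apply: dphiP; rewrite !ltW ?ha.
  apply: derivable_within_continuous => a ha.
  by apply: (@ex_derive _ _ _ _ _ _ _ (dphiP _ _)); rewrite !(itvP ha).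
have {}ha : 0 <= a <= s by rewrite !ltW ?(itvP ha).
pose psi b := 'D_u f (x + a *: u + b *: v).
pose dpsi b := 'D_v ('D_u f) (x + a *: u + b *: v).
have dpsiP b : 0 <= b <= s -> is_derive b 1 psi (dpsi b).
  by move=> hb; apply: is_derive_line; apply: ddf; exact: hU.
have [b hb Eb] : exists2 b, b \in `]0, s[ & psi s - psi 0 = dpsi b * (s - 0).
  apply: (@MVT R psi dpsi 0 s s0) => [b hb|].
    by apply: dpsiP; rewrite !ltW ?(itvP hb).
  apply: derivable_within_continuous => b hb.
  by apply: (@ex_derive _ _ _ _ _ _ _ (dpsiP _ _)); rewrite !(itvP hb).
exists a, b; split => //; first by rewrite !ltW ?(itvP hb).
move: Ea; rewrite subr0 /phi !scale0r !addr0 (addrAC x (s *: v)) => ->.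
move: Eb; rewrite subr0 /psi /dphi scale0r addr0 addrAC => ->.
by rewrite [RHS]mulrC mulrA.
Qed.

Lemma ler_dist_half (p q r e : R) :
  `|p - r| <= e / 2 -> `|q - r| <= e / 2 -> `|p - q| <= e.
Proof.
move=> h1 h2; rewrite -(subrKA r) (le_trans (ler_normD _ _))// (splitr e) lerD//.
by rewrite distrC.
Qed.

(** The second difference is symmetric in u and v, so that the two mixed derivatives take a common
    value at two points of a small parallelogram at x; their continuity concludes. *)
Lemma schwarz_scalar (U : set V) (f : V -> R) (x u v : V) : open U -> U x ->
  Cn_on 2 U f -> 'D_u ('D_v f) x = 'D_v ('D_u f) x.
Proof.
move=> oU Ux Cf; apply/eqP; rewrite -subr_eq0 -normr_le0; apply/ler_addgt0Pr => e e0.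
have e2 : 0 < e / 2 by rewrite divr_gt0.
have [_ c1] := Cf; have [_ /(_ u) cuv] := c1 v; have [_ /(_ v) cvu] := c1 u.
have /cvgrPdist_le/(_ _ e2) nuv := cuv _ Ux.
have /cvgrPdist_le/(_ _ e2) nvu := cvu _ Ux.
have nU : \forall y \near x, U y by exact: open_nbhs_nbhs.
have [d /= d0 hd] := (nbhs_ballP _ _).1 (filterI nU (filterI nuv nvu)).
(* The parallelogram of side [s] stays within s k = d / 2 of x; the 1 allows u and v to vanish. *)
pose k := `|u| + `|v| + 1; have k0 : 0 < k by rewrite ltr_wpDl// addr_ge0.
pose s := d / 2 / k; have s0 : 0 < s by rewrite !divr_gt0.
have hs a b : 0 <= a <= s -> 0 <= b <= s -> ball x d (x + a *: u + b *: v).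
  move=> /andP[a0 as_] /andP[b0 bs].
  rewrite -ball_normE /= -addrA opprD addNKr normrN.
  rewrite (le_lt_trans (ler_normD _ _))// !normrZ !ger0_norm//.
  apply: (@le_lt_trans _ _ (s * k)); last first.
    by rewrite /s divfK ?gt_eqF// ltr_pdivrMr// ltr_pMr// ltr1n.
  rewrite /k !mulrDr mulr1 -addrA lerD ?ler_wpM2r//.
  by rewrite -[leLHS]addr0 lerD ?ler_wpM2r// ltW.
have hU a b : 0 <= a <= s -> 0 <= b <= s -> U (x + a *: u + b *: v).
  by move=> ha hb; have [] := hd _ (hs _ _ ha hb).
have hU' a b : 0 <= a <= s -> 0 <= b <= s -> U (x + a *: v + b *: u).
  by move=> ha hb; rewrite addrAC; exact: hU.
have [a [b [ha hb E1]]] := second_difference Cf s0 hU.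
have [a' [b' [ha' hb' E2]]] := second_difference Cf s0 hU'.
have [_ [_ n1]] := hd _ (hs _ _ ha hb).
have [_ [n2 _]] := hd _ (hs _ _ hb' ha').
have E : 'D_v ('D_u f) (x + a *: u + b *: v) = 'D_u ('D_v f) (x + b' *: u + a' *: v).
  have ss0 : s * s != 0 by rewrite mulf_neq0// gt_eqF.
  have alg (p q r w : R) : p - q - (r - w) = p - r - (q - w) by ring.
  rewrite (addrAC x (a' *: v) (b' *: u)) (addrAC x (s *: v) (s *: u)) in E2.
  exact: (mulfI ss0 (etrans (esym E1) (etrans (alg _ _ _ _) E2))).
rewrite E in n1; rewrite add0r; exact: ler_dist_half n2 n1.
Qed.

Lemma schwarz m n (U : set V) (f : V -> 'M[R]_(m, n)) (x u v : V) :
  open U -> U x -> Cn_on 2 U f -> 'D_u ('D_v f) x = 'D_v ('D_u f) x.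
Proof.
move=> oU Ux Cf; have [df c1] := Cf.
have E a b : 'D_a ('D_b f) x =
    \matrix_(i, j) 'D_a ('D_b (fun y => f y i j : R)) x.
  have [db _] := c1 b; rewrite derive_mx; last exact/diff_derivable/db.
  apply/matrixP => i j; rewrite !mxE; apply: near_eq_derive.
  have nU : \forall y \near x, U y by exact: open_nbhs_nbhs.
  by apply: filterS nU => y Uy; rewrite derive_mx ?mxE//; exact/diff_derivable/df.
rewrite [LHS]E [RHS]E; apply/matrixP => i j; rewrite [LHS]mxE [RHS]mxE.
exact: (schwarz_scalar u v oU Ux (Cn_on_entry i j oU Cf)).
Qed.

End Schwarz.

(** * Koszul formula and Christoffel symbols in coordinates *)

Section LocalLeviCivita.
Context {R : realType} {N : nat}.
Local Notation V := 'rV[R]_N.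
Implicit Types (G J : V -> 'M[R]_N) (Y : V -> 'rV[R]_N) (x a b z : 'rV[R]_N).

Lemma derive_linear_rV (W : normedModType R) (f : V -> W) x a :
  differentiable f x ->
  'D_a f x = \sum_k a 0 k *: 'D_(delta_mx 0 k) f x.
Proof.
move=> df; rewrite (deriveE _ df) [in LHS](row_sum_delta a) linear_sum.
by apply: eq_bigr => k _; rewrite linearZ /= (deriveE _ df).
Qed.

Lemma mx11_tr (A : 'M[R]_1) : A^T = A.
Proof. by apply/matrixP => i j; rewrite mxE !ord1. Qed.

Section koszul.
Implicit Types (D : 'rV[R]_N -> 'M[R]_N).

(* The right-hand side of the Koszul formula for constant vector fields, where
   [D v] is the derivative of the metric along [v]. *)
Definition koszul D a b z : 'M[R]_1 :=
  b *m D a *m z^T + a *m D b *m z^T - a *m D z *m b^T.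

Lemma koszul_sym_sum D a b z : (forall v, (D v)^T = D v) ->
  koszul D a b z + koszul D a z b = 2 *: (b *m D a *m z^T).
Proof.
move=> Ds; rewrite /koszul.
have -> : z *m D a *m b^T = b *m D a *m z^T.
  by rewrite -[LHS]mx11_tr !trmx_mul trmxK Ds mulmxA.
generalize (b *m D a *m z^T) (a *m D b *m z^T) (a *m D z *m b^T) => p q r.
by rewrite scaler_nat mulr2n; apply/matrixP => i j; rewrite !mxE; ring.
Qed.

(** The hypothesis on [D] is the product rule for J G J^T. Of the six terms containing [dJ], four
    cancel by the symmetry of [dJ] and the other two are equal. *)
Lemma koszul_change D D' (dJ : 'rV[R]_N -> 'M[R]_N) (J0 G0 : 'M[R]_N) a b z :
  (forall v, D v = dJ v *m G0 *m J0^T + J0 *m D' (v *m J0) *m J0^T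
    + J0 *m G0 *m (dJ v)^T) ->
  (forall u v, v *m dJ u = u *m dJ v) -> G0^T = G0 ->
  koszul D a b z = 2 *: (b *m dJ a *m G0 *m (z *m J0)^T)
    + koszul D' (a *m J0) (b *m J0) (z *m J0).
Proof.
move=> DE dJs Gs; rewrite /koszul.
have T (u v w : 'rV[R]_N) : u *m D v *m w^T = (u *m dJ v) *m G0 *m (w *m J0)^T
    + (u *m J0) *m D' (v *m J0) *m (w *m J0)^T
    + (u *m J0) *m G0 *m (w *m dJ v)^T.
  by rewrite DE !mulmxDr !mulmxDl !trmx_mul !mulmxA.
rewrite !T (dJs b a) (dJs z a) (dJs z b).
have S (u v : 'rV[R]_N) : u *m G0 *m v^T = v *m G0 *m u^T.
  by rewrite -[LHS]mx11_tr !trmx_mul trmxK Gs mulmxA.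
rewrite (S (b *m J0) (z *m dJ a)).
set p := b *m dJ a *m G0 *m (z *m J0)^T.
set q := z *m dJ a *m G0 *m (b *m J0)^T.
set r := a *m J0 *m G0 *m (z *m dJ b)^T.
set s := b *m J0 *m D' (a *m J0) *m (z *m J0)^T.
set t := a *m J0 *m D' (b *m J0) *m (z *m J0)^T.
set w := a *m J0 *m D' (z *m J0) *m (b *m J0)^T.
move: p q r s t w => p q r s t w.
by rewrite scaler_nat mulr2n; apply/matrixP => i j; rewrite !mxE; ring.
Qed.

End koszul.

Definition row_form (D : 'I_N -> 'M[R]_N) a b : 'rV[R]_N :=
  \row_k (a *m D k *m b^T) 0 0.

(** The Christoffel symbols contracted with a and b: the vector whose product with z is half the
    Koszul form. [row_form] represents the linear form z -> a ('D_z G) b^T. *)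
Definition christoffel G x a b : 'rV[R]_N :=
  2^-1 *: ((b *m 'D_a G x + a *m 'D_b G x
    - row_form (fun k => 'D_(delta_mx 0 k) G x) a b) *m invmx (G x)).

Lemma christoffelP G x a b z : differentiable G x -> G x \in unitmx ->
  christoffel G x a b *m G x *m z^T = 2^-1 *: koszul (fun v => 'D_v G x) a b z.
Proof.
move=> dG Gu; rewrite /christoffel -!scalemxAl (mulmxKV Gu); congr (_ *: _).
rewrite mulmxBl mulmxDl /koszul; congr (_ - _).
rewrite (derive_linear_rV z dG) mulmx_sumr mulmx_suml.
apply/matrixP => i j; rewrite !ord1 mxE summxE.
by apply: eq_bigr => k _; rewrite -scalemxAr -scalemxAl !mxE mulrC.
Qed.

Lemma koszul_eq G x a b (h : 'rV[R]_N) : differentiable G x -> G x \in unitmx ->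
  (forall z, h *m G x *m z^T = 2^-1 *: koszul (fun v => 'D_v G x) a b z) ->
  h = christoffel G x a b.
Proof.
move=> dG Gu H.
suff : h *m G x = christoffel G x a b *m G x.
  by move/(congr1 (mulmx^~ (invmx (G x)))); rewrite !(mulmxK Gu).
apply/rowP => k.
have := congr1 (fun A : 'M[R]_1 => A 0 0)
  (etrans (H (delta_mx 0 k)) (esym (christoffelP a b (delta_mx 0 k) dG Gu))).
by rewrite trmx_delta -!colE !mxE.
Qed.

Definition local_nabla G Y x a : 'rV[R]_N := 'D_a Y x + christoffel G x a (Y x).

Section metric.
Variables (G : V -> 'M[R]_N) (x : V).
(** Symmetry of the metric is assumed near the point because its derivatives must be symmetric
    too. *)
Hypotheses (dG : differentiable G x) (Gu : G x \in unitmx)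
  (Gs : \forall y \near x, (G y)^T = G y).

Lemma derive_sym a : ('D_a G x)^T = 'D_a G x.
Proof. by rewrite -(derive_trmx _ dG); apply: near_eq_derive. Qed.

Lemma local_nabla_metric X Y a : differentiable X x -> differentiable Y x ->
  'D_a (fun y => X y *m G y *m (Y y)^T) x =
  local_nabla G X x a *m G x *m (Y x)^T + X x *m G x *m (local_nabla G Y x a)^T.
Proof.
move=> dX dY; have dXG := differentiable_mulmx dX dG.
have dYt := differentiable_trmx dY.
rewrite (derive_mulmx a dXG dYt) (derive_mulmx a dX dG) (derive_trmx a dY).
have sx := nbhs_singleton Gs.
have E : X x *m 'D_a G x *m (Y x)^T =
    christoffel G x a (X x) *m G x *m (Y x)^T + X x *m G x *m (christoffel G x a (Y x))^T.
  have -> : X x *m G x *m (christoffel G x a (Y x))^T =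
      christoffel G x a (Y x) *m G x *m (X x)^T.
    generalize (christoffel G x a (Y x)) => c.
    by rewrite -[RHS]mx11_tr !trmx_mul trmxK sx mulmxA.
  rewrite (christoffelP _ _ _ dG Gu) (christoffelP _ _ _ dG Gu) -scalerDr.
  rewrite (koszul_sym_sum _ _ _ derive_sym) scalerA mulVf ?pnatr_eq0//.
  by rewrite scale1r.
rewrite /local_nabla mulmxDl E !mulmxDl [(_ + christoffel _ _ _ _)^T]linearD /=.
rewrite mulmxDr.
set p := 'D_a X x *m G x *m (Y x)^T; set q := X x *m G x *m ('D_a Y x)^T.
set r := christoffel G x a (X x) *m G x *m (Y x)^T.
set t := X x *m G x *m (christoffel G x a (Y x))^T.
by rewrite -!addrA; congr (p + (r + _)); rewrite addrC.
Qed.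

End metric.

Section change_coordinates.
Variables (U : set V) (F : V -> V) (J G G' : V -> 'M[R]_N) (x : V).
Hypotheses (oU : open U) (Ux : U x) (CF : Cn_on 2 U F)
  (JE : forall y v, U y -> 'D_v F y = v *m J y)
  (dJ : differentiable J x) (Ju : J x \in unitmx)
  (GE : forall y, U y -> G y = J y *m G' (F y) *m (J y)^T)
  (dG' : differentiable G' (F x)) (Gu' : G' (F x) \in unitmx)
  (Gs' : (G' (F x))^T = G' (F x)).

Let nU : \forall y \near x, U y. Proof. exact: open_nbhs_nbhs. Qed.

Let dF : differentiable F x. Proof. by have [h _] := CF; exact: h. Qed.

Lemma derive_jacobian_sym a b : b *m 'D_a J x = a *m 'D_b J x.
Proof.
have E u v : 'D_u ('D_v F) x = v *m 'D_u J x.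
  have -> : 'D_u ('D_v F) x = 'D_u (fun y => v *m J y) x.
    by apply: near_eq_derive; apply: filterS nU => y; exact: JE.
  rewrite (derive_mulmx u (differentiable_cst v x) dJ) derive_cst mul0mx.
  by rewrite add0r.
by rewrite -(E a b) -(E b a); exact: (schwarz _ _ oU Ux CF).
Qed.

Let dG'F : differentiable (G' \o F) x.
Proof. exact: differentiable_comp. Qed.

Let dJG : differentiable (fun y => J y *m G' (F y)) x.
Proof. exact: differentiable_mulmx. Qed.

Let nGE : \forall y \near x, J y *m G' (F y) *m (J y)^T = G y.
Proof. by apply: filterS nU => y Uy; rewrite GE. Qed.

Lemma differentiable_change : differentiable G x.
Proof.
apply: near_eq_differentiable nGE _; apply: differentiable_mulmx => //.
exact: differentiable_trmx.
Qed.

Lemma derive_change a : 'D_a G x =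
  'D_a J x *m G' (F x) *m (J x)^T + J x *m 'D_(a *m J x) G' (F x) *m (J x)^T
  + J x *m G' (F x) *m ('D_a J x)^T.
Proof.
rewrite -(near_eq_derive _ nGE) (derive_mulmx a dJG (differentiable_trmx dJ)).
rewrite (derive_mulmx a dJ dG'F) (derive_trmx a dJ) (derive_comp _ dF dG').
by rewrite (JE _ Ux) mulmxDl.
Qed.

(** The classical transformation law, proved through the characterization [koszul_eq]. The
    inhomogeneous term matches the derivative of J when Y J is differentiated, which makes
    [local_nabla] independent of coordinates. *)
Lemma christoffel_change a b : christoffel G x a b *m J x =
  b *m 'D_a J x + christoffel G' (F x) (a *m J x) (b *m J x).
Proof.
have Gu : G x \in unitmx.
  by rewrite (GE Ux) !unitmx_mul unitmx_tr Ju Gu'.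
rewrite -[RHS](mulmxKV Ju); congr (_ *m _); apply/esym.
apply: (koszul_eq differentiable_change Gu) => z.
have := christoffelP (a *m J x) (b *m J x) (z *m J x) dG' Gu'.
have := koszul_change a b z derive_change derive_jacobian_sym Gs' => ->.
rewrite (scalerDr 2^-1 (2 *: _)) scalerA mulVf ?pnatr_eq0// scale1r => <-.
have JK w : w *m invmx (J x) *m J x = w by exact: (mulmxKV Ju).
rewrite (GE Ux) trmx_mul.
generalize (christoffel G' (F x) (a *m J x) (b *m J x)) (b *m 'D_a J x) => c h.
by rewrite !mulmxA JK !mulmxDl.
Qed.

Lemma local_nabla_change Y Y' a : differentiable Y x -> differentiable Y' (F x) ->
  (forall y, U y -> Y' (F y) = Y y *m J y) ->
  local_nabla G Y x a *m J x = local_nabla G' Y' (F x) (a *m J x).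
Proof.
move=> dY dY' YE; rewrite /local_nabla mulmxDl christoffel_change addrA.
rewrite (YE _ Ux); congr (_ + _).
have := derive_comp a dF dY'; rewrite (JE _ Ux) => <-.
have -> : 'D_a (Y' \o F) x = 'D_a (fun y => Y y *m J y) x.
  by apply: near_eq_derive; apply: filterS nU => y; exact: YE.
by rewrite (derive_mulmx a dY dJ).
Qed.

End change_coordinates.

Section smoothness.
Variables (U : set V) (oU : open U).

Lemma smooth_derive_along m n (f : V -> 'M[R]_(m, n)) (X : V -> V) :
  smooth_on U f -> smooth_on U X -> smooth_on U (fun x => 'D_(X x) f x).
Proof.
move=> sf sX k; have [df cf] := sf k.+1.
apply: (@Cn_on_eq _ _ _ _ _ (fun x => \sum_k X x 0 k *: 'D_(delta_mx 0 k) f x)) => //.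
  by move=> x; rewrite inE => Ux; rewrite -derive_linear_rV//; exact: df.
apply: Cn_on_sum => // l _; apply: Cn_on_mxZ => //; last exact: cf.
by apply: Cn_on_entry => //; exact: sX.
Qed.

Lemma smooth_local_nabla G X Y :
  {in U, forall x, G x \in unitmx} -> smooth_on U G -> smooth_on U X ->
  smooth_on U Y -> smooth_on U (fun x => local_nabla G Y x (X x)).
Proof.
move=> Gu sG sX sY k.
apply: Cn_onD => //; first exact: (smooth_derive_along sY sX).
apply: Cn_on_mxZ => //; first exact: Cn_on_cst.
apply: Cn_on_mulmx => //; last exact: Cn_on_invmx.
apply: Cn_on_mxB => //.
  apply: Cn_onD => //; apply: Cn_on_mulmx => //.
    exact: (smooth_derive_along sG sX).
  exact: (smooth_derive_along sG sY).
rewrite /row_form; apply: Cn_on_mx => // _ j; apply: Cn_on_entry => //.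
apply: Cn_on_mulmx => //; last exact: Cn_on_trmx.
apply: Cn_on_mulmx => //.
by have [_] := sG k.+1; exact.
Qed.

End smoothness.

End LocalLeviCivita.

(** * Linearity and Leibniz rule in coordinates *)

Section LocalLinearity.
Context {R : realType} {N : nat}.
Local Notation V := 'rV[R]_N.
Implicit Types (G : V -> 'M[R]_N) (Y : V -> 'rV[R]_N) (f : V -> R).

Lemma derive_dirP (W : normedModType R) (f : V -> W) x (s : R) a b :
  differentiable f x -> 'D_(s *: a + b) f x = s *: 'D_a f x + 'D_b f x.
Proof. by move=> df; rewrite !(deriveE _ df) linearP. Qed.

Lemma derive_entry m n (A : V -> 'M[R]_(m, n)) x v i j : differentiable A x ->
  'D_v (fun y => A y i j : R) x = 'D_v A x i j.
Proof. by move=> dA; rewrite derive_mx ?mxE//; exact: diff_derivable. Qed.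

Lemma differentiable_mxZ m n (f : V -> R) (A : V -> 'M[R]_(m, n)) x :
  differentiable f x -> differentiable A x ->
  differentiable (fun y => f y *: A y) x.
Proof.
move=> df /differentiable_mxP dA; apply/differentiable_mxP => i j.
rewrite (_ : (fun y => _) = f * (fun y => A y i j)).
  exact: differentiableM.
by apply/funext => y; rewrite mxE.
Qed.

Lemma derive_mxZ m n (f : V -> R) (A : V -> 'M[R]_(m, n)) x v :
  differentiable f x -> differentiable A x ->
  'D_v (fun y => f y *: A y) x = 'D_v f x *: A x + f x *: 'D_v A x.
Proof.
move=> df dA; apply/matrixP => i j.
rewrite -(derive_entry v i j (differentiable_mxZ df dA)).
rewrite (_ : (fun y => _) = f * (fun y => A y i j : R)); last first.
  by apply/funext => y; rewrite mxE.
rewrite deriveM; last 2 first.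
- exact: diff_derivable.
- by apply: diff_derivable; move/differentiable_mxP: dA.
by rewrite (derive_entry v i j dA) !mxE addrC; congr (_ + _); exact: mulrC.
Qed.

Lemma row_form_linl (D : 'I_N -> 'M[R]_N) (s : R) (a a' b : V) :
  row_form D (s *: a + a') b = s *: row_form D a b + row_form D a' b.
Proof.
apply/rowP => k; rewrite [LHS]mxE mulmxDl mulmxDl -scalemxAl -scalemxAl.
rewrite [LHS]mxE [RHS]mxE; congr (_ + _); last by rewrite [RHS]mxE.
by rewrite [LHS]mxE [RHS]mxE; congr (_ * _); rewrite [RHS]mxE.
Qed.

Lemma row_form_linr (D : 'I_N -> 'M[R]_N) (s : R) (a b b' : V) :
  row_form D a (s *: b + b') = s *: row_form D a b + row_form D a b'.
Proof.
apply/rowP => k; rewrite [LHS]mxE [(s *: b + b')^T]linearP /= mulmxDr -scalemxAr.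
rewrite [LHS]mxE [RHS]mxE; congr (_ + _); last by rewrite [RHS]mxE.
by rewrite [LHS]mxE [RHS]mxE; congr (_ * _); rewrite [RHS]mxE.
Qed.

Lemma christoffel_linl G x (s : R) a a' b : differentiable G x ->
  christoffel G x (s *: a + a') b = s *: christoffel G x a b + christoffel G x a' b.
Proof.
move=> dG; rewrite /christoffel (derive_dirP s a a' dG) row_form_linl.
rewrite scalerA mulrC -scalerA -scalerDr [s *: (_ *m _)]scalemxAl -mulmxDl.
congr (_ *: (_ *m _)).
set p := 'D_a G x; set q := 'D_a' G x; set r := 'D_b G x.
set t := row_form _ a b; set w := row_form _ a' b; move: p q r t w => p q r t w.
rewrite mulmxDr mulmxDl -scalemxAr -scalemxAl.
by apply/rowP => k; rewrite !mxE; ring.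
Qed.

Lemma christoffel_linr G x (s : R) a b b' : differentiable G x ->
  christoffel G x a (s *: b + b') = s *: christoffel G x a b + christoffel G x a b'.
Proof.
move=> dG; rewrite /christoffel (derive_dirP s b b' dG) row_form_linr.
rewrite scalerA mulrC -scalerA -scalerDr [s *: (_ *m _)]scalemxAl -mulmxDl.
congr (_ *: (_ *m _)).
set p := 'D_b G x; set q := 'D_b' G x; set r := 'D_a G x.
set t := row_form _ a b; set w := row_form _ a b'; move: p q r t w => p q r t w.
rewrite mulmxDr mulmxDl -scalemxAr -scalemxAl.
by apply/rowP => k; rewrite !mxE; ring.
Qed.

Lemma local_nabla_lin G Y x (s : R) a a' : differentiable G x ->
  differentiable Y x ->
  local_nabla G Y x (s *: a + a') = s *: local_nabla G Y x a + local_nabla G Y x a'.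
Proof.
move=> dG dY; rewrite /local_nabla (derive_dirP s a a' dY) christoffel_linl//.
by rewrite scalerDr; exact: addrACA.
Qed.

Lemma local_nablaD G Y Y' x a : differentiable G x -> differentiable Y x ->
  differentiable Y' x ->
  local_nabla G (Y + Y') x a = local_nabla G Y x a + local_nabla G Y' x a.
Proof.
move=> dG dY dY'; rewrite /local_nabla.
rewrite (deriveD (diff_derivable dY) (diff_derivable dY')).
have := christoffel_linr 1 a (Y x) (Y' x) dG; rewrite !scale1r => E.
by rewrite [christoffel _ _ _ _]E; exact: addrACA.
Qed.

Lemma local_nablaZ G f Y x a : differentiable G x -> differentiable f x ->
  differentiable Y x ->
  local_nabla G (fun y => f y *: Y y) x a
    = 'D_a f x *: Y x + f x *: local_nabla G Y x a.
Proof.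
move=> dG df dY; rewrite /local_nabla (derive_mxZ a df dY).
(* Linearity is stated for [s *: b + b']; taking both vectors zero first shows that [christoffel]
   vanishes at 0. *)
have E := christoffel_linr 1 a (0 : V) (0 : V) dG.
rewrite !scale1r addr0 -[LHS]addr0 in E.
have E' := christoffel_linr (f x) a (Y x) (0 : V) dG.
by rewrite addr0 -(addrI _ E) addr0 in E'; rewrite E' scalerDr addrA.
Qed.

End LocalLinearity.

(** * The Levi-Civita connection on the manifold *)

Section LeviCivita.
Context {R : realType} {N : nat} {M : manifold R N}.
Variable g : M -> 'M[R]_N.
Hypothesis rg : riemannian_metric g.
Implicit Types (X Y Z : M -> 'rV[R]_N) (p : M) (c : chart R N M).

Local Notation vec c X := (vector_in c X \o chart_inv c).
Local Notation met c := (bilin_in c g \o chart_inv c).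

Definition levi_civita X Y : M -> 'rV[R]_N := fun p =>
  local_nabla (met (chart_at p)) (vec (chart_at p) Y) (chart_map (chart_at p) p) (X p).

Lemma bilin_in_posdef c p : atlas c -> chart_dom c p -> posdef (bilin_in c g p).
Proof.
move=> ac cp; rewrite /bilin_in; apply: posdef_congr; last exact: riemannian_posdef.
exact: (change_unit ac (chart_at_atlas p) cp (chart_at_dom p)).
Qed.

Lemma metric_diff c p : atlas c -> chart_dom c p ->
  differentiable (met c) (chart_map c p).
Proof.
move=> ac cp; have [sg _ _] := rg.
exact: (smooth_on_diff (sg c ac) (chart_imgP cp)).
Qed.

Lemma vector_diff c p X : atlas c -> chart_dom c p -> smooth_vector_field X ->
  differentiable (vec c X) (chart_map c p).
Proof. by move=> ac cp sX; exact: (smooth_on_diff (sX c ac) (chart_imgP cp)). Qed.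

(** [levi_civita] is computed at each point in that point's own chart; invariance under transitions
    gives its expression in a fixed chart, where smoothness is visible. *)
Lemma levi_civita_in c p X Y : atlas c -> chart_dom c p -> smooth_vector_field Y ->
  vector_in c (levi_civita X Y) p =
  local_nabla (met c) (vec c Y) (chart_map c p) (vector_in c X p).
Proof.
move=> ac cp sY; rewrite {1}/vector_in /levi_civita.
move: (chart_at p) (chart_at_atlas p) (chart_at_dom p)
  (vector_in_change (chart_at_atlas p) ac (chart_at_dom p) cp X)
  (vector_in_at X p) => d ad dp -> ->.
have FE := transition_map c dp.
have imgE q : chart_dom d q -> chart_dom c q ->
    chart_inv c (transition d c (chart_map d q)) = q.
  by move=> dq cq; rewrite (transition_map c dq) (chart_mapK cq).
pose U := chart_map d @` (chart_dom d `&` chart_dom c).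
pose J := change d c \o chart_inv d.
have JE : J (chart_map d p) = change d c p by rewrite /J /= (chart_mapK dp).
rewrite -FE -JE.
refine (@local_nabla_change R N U (transition d c) J (met d) (met c)
  (chart_map d p) _ _ _ _ _ _ _ _ _ _ (vec d Y) (vec c Y) _ _ _ _).
- by apply: chart_image_open; exact: chart_dom_open.
- exact: (ex_intro2 _ _ p (conj dp cp) erefl).
- exact: (transition_smooth ad ac).
- by move=> _ v [q [dq cq] <-]; rewrite /J /= (chart_mapK dq);
  exact: (derive_transition v ad ac dq cq).
- exact: (smooth_on_diff (smooth_change ad ac) (ex_intro2 _ _ p (conj dp cp) erefl)).
- by rewrite JE; exact: (change_unit ad ac dp cp).
- move=> _ [q [dq cq] <-]; rewrite /J /= (imgE _ dq cq) (chart_mapK dq).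
  exact: (bilin_in_change ac ad cq dq).
- by rewrite FE; exact: metric_diff.
- by rewrite FE /= (chart_mapK cp); apply: posdef_unit; exact: bilin_in_posdef.
- by rewrite FE /= (chart_mapK cp); exact: (bilin_in_posdef ac cp).1.
- exact: vector_diff.
- by rewrite FE; exact: vector_diff.
- move=> _ [q [dq cq] <-]; rewrite /J /= (imgE _ dq cq) (chart_mapK dq).
  exact: (vector_in_change ad ac dq cq).
Qed.

Lemma levi_civita_connection : affine_connection levi_civita.
Proof.
have [sg _ _] := rg.
have md p : differentiable (met (chart_at p)) (chart_map (chart_at p) p).
  exact: metric_diff (chart_at_atlas p) (chart_at_dom p).
have vd X p : smooth_vector_field X ->
    differentiable (vec (chart_at p) X) (chart_map (chart_at p) p).
  exact: vector_diff (chart_at_atlas p) (chart_at_dom p).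
split.
- move=> X Y sX sY c ac k; have oc : open (chart_img c) := chart_img_open (c := c).
  apply: (@Cn_on_eq _ _ _ _ _ (fun x => local_nabla (met c) (vec c Y) x (vec c X x))) => //.
    move=> x; rewrite inE => /chart_img_dom[h hx].
    have E := levi_civita_in X ac h sY; rewrite hx in E; exact: (esym E).
  apply: smooth_local_nabla => //; [|exact: sg|exact: sX|exact: sY].
  move=> x; rewrite inE => /chart_img_dom[h _].
  by apply: posdef_unit; exact: bilin_in_posdef.
- move=> X X' Y sX sX' sY; apply/funext => p; rewrite /levi_civita.
  by rewrite -[X p]scale1r (local_nabla_lin _ _ _ (md p) (vd Y p sY)) !scale1r.
- move=> f X Y sf sX sY; apply/funext => p; rewrite /levi_civita.
  have H s a a' := local_nabla_lin s a a' (md p) (vd Y p sY).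
  have H0 := H 1 0 0; rewrite scale1r addr0 scale1r in H0.
  move/eqP: H0; rewrite -subr_eq0 opprD addrA subrr sub0r oppr_eq0 => /eqP H0.
  by rewrite -[f p *: X p]addr0 H H0 addr0.
- move=> X Y Y' sX sY sY'; apply/funext => p; rewrite /levi_civita.
  have E : vec (chart_at p) (fun q => Y q + Y' q) =
      vec (chart_at p) Y + vec (chart_at p) Y'.
    by apply/funext => x; exact: mulmxDl.
  exact: (etrans (congr1 (fun F => local_nabla _ F _ _) E)
    (local_nablaD _ (md p) (vd Y p sY) (vd Y' p sY'))).
- move=> f X Y sf sX sY; apply/funext => p; rewrite /levi_civita.
  have df : differentiable (f \o chart_inv (chart_at p)) (chart_map (chart_at p) p).
    apply: (smooth_on_diff (sf _ (chart_at_atlas p))).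
    exact: chart_imgP (chart_at_dom p).
  have E : vec (chart_at p) (fun q => f q *: Y q) =
      (fun x => (f \o chart_inv (chart_at p)) x *: vec (chart_at p) Y x).
    by apply/funext => x; rewrite /= /vector_in scalemxAl.
  rewrite [LHS](etrans (congr1 (fun F => local_nabla _ F _ _) E)
    (local_nablaZ (X p) (md p) df (vd Y p sY))).
  by rewrite /= (chart_mapK (chart_at_dom p)) (vector_in_at Y).
Qed.

Lemma bilin_fields_near c p X Y : atlas c -> chart_dom c p ->
  \forall x \near chart_map c p, (bilin_fields g X Y \o chart_inv c) x =
    ((vec c X x) *m (met c x) *m (vec c Y x)^T) 0 0.
Proof.
move=> ac cp; have := chart_near cp (chart_dom_near cp).
by apply: filterS => x [_ h]; rewrite /= (bilin_fields_in ac h).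
Qed.

Lemma bilin_product_diff c p X Y : atlas c -> chart_dom c p ->
  smooth_vector_field X -> smooth_vector_field Y ->
  differentiable (fun x => vec c X x *m met c x *m (vec c Y x)^T) (chart_map c p).
Proof.
move=> ac cp sX sY; apply: differentiable_mulmx.
  apply: differentiable_mulmx; first exact: vector_diff.
  exact: metric_diff.
by apply: differentiable_trmx; exact: vector_diff.
Qed.

Lemma bilin_fields_diff c p X Y : atlas c -> chart_dom c p ->
  smooth_vector_field X -> smooth_vector_field Y ->
  differentiable (bilin_fields g X Y \o chart_inv c) (chart_map c p).
Proof.
move=> ac cp sX sY.
have /differentiable_mxP/(_ 0 0) h := bilin_product_diff ac cp sX sY.
apply: near_eq_differentiable h; have := bilin_fields_near X Y ac cp.
by apply: filterS => x ->.
Qed.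

Lemma levi_civita_self_dual : self_dual g levi_civita.
Proof.
move=> X Y Z sX sY sZ; apply/funext => p; rewrite /lie_function.
have ac := chart_at_atlas p; have cp := chart_at_dom p.
rewrite (near_eq_derive _ (bilin_fields_near X Y ac cp)).
rewrite (derive_entry _ _ _ (bilin_product_diff ac cp sX sY)).
have Gs : \forall y \near chart_map (chart_at p) p,
    (met (chart_at p) y)^T = met (chart_at p) y.
  have := chart_near cp (chart_dom_near cp).
  by apply: filterS => x [_ h]; exact: (bilin_in_posdef ac h).1.
have Gu : met (chart_at p) (chart_map (chart_at p) p) \in unitmx.
  by rewrite /= (chart_mapK cp); apply: posdef_unit; exact: bilin_in_posdef.
rewrite (local_nabla_metric (metric_diff ac cp) Gu Gs (Z p)
  (vector_diff ac cp sX) (vector_diff ac cp sY)).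
rewrite mxE !(bilin_fields_in ac cp) !vector_in_at /levi_civita /=.
by rewrite (chart_mapK cp) !vector_in_at.
Qed.

End LeviCivita.

(** * A metric connection adapted to an almost contact structure *)

Section AdaptedConnection.
Context {R : realType} {N : nat} {M : manifold R N}.
Variables (g theta : M -> 'M[R]_N)
  (D : (M -> 'rV[R]_N) -> (M -> 'rV[R]_N) -> (M -> 'rV[R]_N)).
Hypotheses (rg : riemannian_metric g) (st : smooth_endo theta)
  (skew : skew_symmetric g theta)
  (theta3 : forall p, theta p *m theta p *m theta p = - theta p)
  (aD : affine_connection D) (sD : self_dual g D).
Implicit Types (X Y Z : M -> 'rV[R]_N) (p : M).

Let T := endo_field theta.
Let E := fun Y => T (T Y).

(* With h = - theta^2 and P = 1 + theta^2, this is
   P D_X (P Y) + (h D_X (h Y) - theta D_X (theta Y)) / 2,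
   the average of D over the complex structure on the image of theta. *)
Definition adapted X Y : M -> 'rV[R]_N := fun p =>
  D X Y p + D X (E Y) p + D X Y p *m theta p *m theta p
  + (3 / 2) *: (D X (E Y) p *m theta p *m theta p)
  - 2^-1 *: (D X (T Y) p *m theta p).

Let sT Y : smooth_vector_field Y -> smooth_vector_field (T Y).
Proof. exact: smooth_endo_field. Qed.

Let sE Y : smooth_vector_field Y -> smooth_vector_field (E Y).
Proof. by move=> sY; do 2 apply: sT. Qed.

Let TD Y Y' : T (fun p => Y p + Y' p) = (fun p => T Y p + T Y' p).
Proof. by apply/funext => p; exact: mulmxDl. Qed.

Let TZ f Y : T (fun p => f p *: Y p) = (fun p => f p *: T Y p).
Proof. by apply/funext => p; rewrite /T /endo_field /endo_app scalemxAl. Qed.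

Let ED Y Y' : E (fun p => Y p + Y' p) = (fun p => E Y p + E Y' p).
Proof. by rewrite /E !TD. Qed.

Let EZ f Y : E (fun p => f p *: Y p) = (fun p => f p *: E Y p).
Proof. by rewrite /E !TZ. Qed.

Let EE Y p : E Y p = Y p *m theta p *m theta p.
Proof. by []. Qed.

Let T3 p (v : 'rV[R]_N) : v *m theta p *m theta p *m theta p = - (v *m theta p).
Proof. by rewrite -(mulmxA v) -mulmxA theta3 mulmxN. Qed.

Lemma adapted_connection : affine_connection adapted.
Proof.
split.
- move=> X Y sX sY.
  have sDY := conn_smooth aD sX sY; have sDE := conn_smooth aD sX (sE sY).
  have sDT := conn_smooth aD sX (sT sY).
  have s1 := smooth_vectorD (smooth_vectorD (smooth_vectorD sDY sDE) (sE sDY))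
    (smooth_vectorZc (3 / 2) (sE sDE)).
  have := smooth_vectorD s1 (smooth_vectorZc (- 2^-1) (sT sDT)).
  congr smooth_vector_field; apply/funext => p.
  by rewrite /adapted -scaleNr.
- move=> X X' Y sX sX' sY; apply/funext => p; rewrite /adapted.
  rewrite (conn_addl aD sX sX' sY) (conn_addl aD sX sX' (sE sY)).
  rewrite (conn_addl aD sX sX' (sT sY)).
  generalize (D X Y p) (D X' Y p) (D X (E Y) p) (D X' (E Y) p) (D X (T Y) p)
    (D X' (T Y) p) => a a' b b' c c'.
  rewrite !mulmxDl; generalize (a *m theta p *m theta p) (a' *m theta p *m theta p)
    (b *m theta p *m theta p) (b' *m theta p *m theta p) (c *m theta p)
    (c' *m theta p) => d d' e e' f f'.
  by apply/rowP => i; rewrite !mxE; ring.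
- move=> f X Y sf sX sY; apply/funext => p; rewrite /adapted.
  rewrite (conn_scalel aD sf sX sY) (conn_scalel aD sf sX (sE sY)).
  rewrite (conn_scalel aD sf sX (sT sY)) -!scalemxAl.
  generalize (D X Y p) (D X (E Y) p) (D X (T Y) p) => a b c.
  generalize (a *m theta p *m theta p) (b *m theta p *m theta p) (c *m theta p).
  by move=> d e h; apply/rowP => i; rewrite !mxE; ring.
- move=> X Y Y' sX sY sY'; apply/funext => p; rewrite /adapted ED TD.
  rewrite (conn_addr aD sX sY sY') (conn_addr aD sX (sE sY) (sE sY')).
  rewrite (conn_addr aD sX (sT sY) (sT sY')).
  generalize (D X Y p) (D X Y' p) (D X (E Y) p) (D X (E Y') p) (D X (T Y) p)
    (D X (T Y') p) => a a' b b' c c'.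
  rewrite !mulmxDl; generalize (a *m theta p *m theta p) (a' *m theta p *m theta p)
    (b *m theta p *m theta p) (b' *m theta p *m theta p) (c *m theta p)
    (c' *m theta p) => d d' e e' f f'.
  by apply/rowP => i; rewrite !mxE; ring.
(* As theta^4 = - theta^2, the terms in X(f) add up to Y + (1 + 1 - 3/2 - 1/2) theta^2 Y = Y. *)
- move=> f X Y sf sX sY; apply/funext => p; rewrite /adapted EZ TZ.
  rewrite (conn_leibniz aD sf sX sY) (conn_leibniz aD sf sX (sE sY)).
  rewrite (conn_leibniz aD sf sX (sT sY)).
  generalize (D X Y p) (D X (E Y) p) (D X (T Y) p) (lie_function X f p) => a b c l.
  change (T Y p) with (Y p *m theta p).
  change (E Y p) with (Y p *m theta p *m theta p).
  rewrite !mulmxDl -!scalemxAl !T3; generalize (Y p) => y.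
  generalize (a *m theta p *m theta p) (b *m theta p *m theta p) (c *m theta p)
    (y *m theta p *m theta p).
  by move=> d e h z; apply/rowP => i; rewrite !mxE; field.
Qed.

Let lie_cst X (a : R) p : lie_function X (fun=> a) p = 0.
Proof. exact: derive_cst. Qed.

Let DN X Y p : smooth_vector_field X -> smooth_vector_field Y ->
  D X (fun p => - Y p) p = - D X Y p.
Proof.
move=> sX sY; have sc : smooth_function (fun _ : M => -1 : R).
  by move=> c ac k; exact: Cn_on_cst.
have := conn_leibniz aD sc sX sY => /(congr1 (@^~ p)) /=.
rewrite lie_cst scale0r add0r scaleN1r => <-.
by congr (D X _ p); apply/funext => q; rewrite scaleN1r.
Qed.

(** Since theta P = P theta = 0 and theta h = h theta = theta, both terms of the covariant
    derivative equal (h D_X (theta Y) + theta D_X (h Y)) / 2. *)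
Lemma adapted_parallel : parallel_endo adapted theta.
Proof.
move=> X Y sX sY; apply/funext => p; rewrite /cov_deriv_endo -/(T Y).
have ET : E (T Y) = (fun q => - T Y q).
  by apply/funext => q; exact: T3.
have TT : T (T Y) = E Y by [].
rewrite /endo_field /endo_app /adapted ET TT (DN _ sX (sT sY)).
generalize (D X Y p) (D X (E Y) p) (D X (T Y) p) => a b c.
rewrite !mulmxDl !mulNmx -!scalemxAl.
rewrite !T3.
set h := c *m theta p *m theta p; set d := a *m theta p; set e := b *m theta p.
by move: d e h => d e h; apply/rowP => i; rewrite !mxE; field.
Qed.

Let bilinDl p (u v w : 'rV[R]_N) :
  bilin_app g p (u + v) w = bilin_app g p u w + bilin_app g p v w.
Proof. by rewrite /bilin_app !mulmxDl mxE. Qed.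

Let bilinZl p a (u w : 'rV[R]_N) :
  bilin_app g p (a *: u) w = a * bilin_app g p u w.
Proof. by rewrite /bilin_app -!scalemxAl mxE. Qed.

Let bilinT p (u v : 'rV[R]_N) :
  bilin_app g p (u *m theta p) v = - bilin_app g p u (v *m theta p).
Proof. exact: skew. Qed.

Let bilin_adapted X Y p (w : 'rV[R]_N) : bilin_app g p (adapted X Y p) w =
  bilin_app g p (D X Y p) w + bilin_app g p (D X (E Y) p) w
  + bilin_app g p (D X Y p) (w *m theta p *m theta p)
  + 3 / 2 * bilin_app g p (D X (E Y) p) (w *m theta p *m theta p)
  + 2^-1 * bilin_app g p (D X (T Y) p) (w *m theta p).
Proof. by rewrite /adapted -scaleNr !bilinDl !bilinZl !bilinT !opprK mulNr mulrN opprK. Qed.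

(** P and h are self-adjoint and theta is skew, so that metricity of D turns the right-hand side
    into the derivative along X of g(PY, PZ) + (g(hY, hZ) + g(theta Y, theta Z)) / 2. This function
    is g(Y, Z), as g(hY, hZ) = g(theta Y, theta Z). In expanded form it is a linear combination of
    five instances of metricity. *)
Lemma adapted_self_dual : self_dual g adapted.
Proof.
have [_ gs _] := rg.
move=> Y Z X sY sZ sX; apply/funext => p.
rewrite /bilin_fields (gs p (Y p)) !bilin_adapted.
have L A B : smooth_vector_field A -> smooth_vector_field B ->
    lie_function X (bilin_fields g A B) p =
    bilin_app g p (D X A p) (B p) + bilin_app g p (D X B p) (A p).
  by move=> sA sB; rewrite (sD sA sB sX) /bilin_fields (gs p (A p)).
have m1 : bilin_fields g (E Y) Z = (fun q => - bilin_fields g (T Y) (T Z) q).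
  by apply/funext => q; exact: bilinT.
have m2 : bilin_fields g Y (E Z) = (fun q => - bilin_fields g (T Y) (T Z) q).
  apply/funext => q; rewrite /bilin_fields -[RHS]opprK opprK.
  by rewrite [bilin_app g q (T Y q) _]bilinT opprK.
have m3 : bilin_fields g (E Y) (E Z) = bilin_fields g (T Y) (T Z).
  apply/funext => q; rewrite /bilin_fields.
  rewrite [LHS]bilinT /E /T /endo_field /endo_app.
  by rewrite T3 /bilin_app linearN /= mulmxN mxE opprK.
have LN A : differentiable ((bilin_fields g (T Y) (T Z)) \o chart_inv (chart_at p))
      (chart_map (chart_at p) p) -> A = (fun q => - bilin_fields g (T Y) (T Z) q) ->
    lie_function X A p = - lie_function X (bilin_fields g (T Y) (T Z)) p.
  move=> dA ->; rewrite /lie_function.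
  exact: (deriveN (diff_derivable dA)).
have dT := bilin_fields_diff rg (chart_at_atlas p) (chart_at_dom p) (sT sY) (sT sZ).
have l0 := L _ _ sY sZ.
have l1 := L _ _ (sE sY) sZ; rewrite (LN _ dT m1) in l1.
have l2 := L _ _ sY (sE sZ); rewrite (LN _ dT m2) in l2.
have l3 := L _ _ (sE sY) (sE sZ); rewrite m3 in l3.
have l4 := L _ _ (sT sY) (sT sZ).
move: l0 l1 l2 l3 l4; rewrite !EE /T /endo_field /endo_app -/T.
lra.
Qed.

End AdaptedConnection.

(** * Pointwise algebra of an almost contact metric structure *)

Section ContactToKernel.
Context {R : realType} {m : nat}.
Local Notation N := (m + 1)%N.
Variables (theta g : 'M[R]_N) (xi : 'rV[R]_N) (eta : 'cV[R]_N).
Hypotheses (xieta : (xi *m eta) 0 0 = 1)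
  (theta2 : theta *m theta = - 1%:M + eta *m xi)
  (isom : theta *m g *m theta^T = g - eta *m eta^T).

Let xieta1 : xi *m eta = 1%:M.
Proof. by rewrite [LHS]mx11_scalar xieta. Qed.

(** theta^2 kills [xi], hence also [xi *m theta], which is then a multiple c xi; applying theta
    again gives c^2 = 0. *)
Let xi_theta : xi *m theta = 0.
Proof.
have h0 : xi *m theta *m theta = 0.
  by rewrite -mulmxA theta2 mulmxDr mulmxN mulmx1 mulmxA xieta1 mul1mx addNr.
have h1 : xi *m theta = (xi *m theta *m eta) *m xi.
  have := congr1 (mulmx^~ theta) h0.
  rewrite /= mul0mx -mulmxA theta2 mulmxDr mulmxN mulmx1 mulmxA addrC => /eqP.
  by rewrite subr_eq0 => /eqP.
rewrite [xi *m theta *m eta]mx11_scalar mul_scalar_mx in h1.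
set c := (xi *m theta *m eta) 0 0 in h1.
have := h0; rewrite h1 -scalemxAl h1 scalerA => /(congr1 (mulmx^~ eta)).
rewrite mul0mx -scalemxAl xieta1 => /matrixP/(_ 0 0)/eqP.
rewrite !mxE mulr1 mulf_eq0 orbb => /eqP ->.
by rewrite scale0r.
Qed.

Lemma contact_theta3 : theta *m theta *m theta = - theta.
Proof. by rewrite theta2 mulmxDl mulNmx mul1mx -mulmxA xi_theta mulmx0 addr0. Qed.

Let theta_eta : theta *m eta = 0.
Proof.
have := contact_theta3; rewrite -mulmxA theta2 mulmxDr mulmxN mulmx1 -[RHS]addr0.
move=> /addrI /(congr1 (mulmx^~ eta)); rewrite mul0mx -!mulmxA xieta1 mulmx1.
by [].
Qed.

(** Multiplied by theta, the isometry identity becomes theta^2 g theta^T = theta g; in the expansion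
    of theta^2 the term eta xi g theta^T = eta (theta eta)^T vanishes. *)
Lemma contact_skew : theta *m g = - (g *m theta^T).
Proof.
have xig : xi *m g = eta^T.
  have := congr1 (mulmx xi) isom; rewrite !mulmxA xi_theta !mul0mx mulmxBr mulmxA.
  by rewrite xieta1 mul1mx => /esym/eqP; rewrite subr_eq0 => /eqP.
have := congr1 (mulmx theta) isom; rewrite mulmxBr (mulmxA theta eta) theta_eta.
rewrite mul0mx subr0 !mulmxA theta2 => <-; rewrite !mulmxDl -(mulmxA eta xi) xig.
by rewrite -(mulmxA eta) -trmx_mul theta_eta trmx0 mulmx0 addr0 mulNmx mul1mx mulNmx.
Qed.

(** If v theta = 0, the formula for theta^2 gives v = (v eta) xi: the kernel is the line of [xi]. *)
Lemma contact_rank : \rank theta = m.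
Proof.
have x0 : xi != 0.
  apply/eqP => x0; have := xieta; rewrite x0 mul0mx mxE => /esym/eqP.
  by rewrite oner_eq0.
have kE : (kermx theta :=: xi)%MS.
  apply/eqmxP/andP; split; last exact/sub_kermxP.
  apply/rV_subP => v /sub_kermxP vt.
  have := congr1 (mulmx^~ theta) vt; rewrite mul0mx -mulmxA theta2 mulmxDr mulmxN.
  rewrite mulmx1 mulmxA addrC => /eqP; rewrite subr_eq0 => /eqP <-.
  exact: submxMl.
have := mxrank_ker theta; rewrite kE rank_rV x0 /= => h.
by rewrite -(subKn (rank_leq_row theta)) -h addnK.
Qed.

End ContactToKernel.

(** [2 * n] and the [n + n] of the frames are not convertible; a variable [m] with an equation
    avoids casts in the matrix types. *)
Lemma contact_iff (R : realType) (n m : nat) (M : manifold R (m + 1)) :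
  m = (n + n)%N -> orientable M ->
  (exists (theta : M -> 'M[R]_(m + 1)) (xi : M -> 'rV[R]_(m + 1))
          (eta : M -> 'cV[R]_(m + 1)) (g : M -> 'M[R]_(m + 1)),
     almost_contact_metric theta xi eta g)
  <->
  (exists g : M -> 'M[R]_(m + 1),
     riemannian_metric g /\
     exists (nabla : (M -> 'rV[R]_(m + 1)) -> (M -> 'rV[R]_(m + 1)) ->
                     (M -> 'rV[R]_(m + 1)))
            (theta : M -> 'M[R]_(m + 1)),
       (affine_connection nabla /\ self_dual g nabla) /\
       (smooth_endo theta /\ skew_symmetric g theta /\
        constant_rank theta m) /\
       parallel_endo nabla theta).
Proof.
move=> mE [A [Aa Ac Ad]]; split.
  move=> [theta [xi [eta [g [[st _ _ rg] h1 h2 h3]]]]].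
  have t2 p : theta p *m theta p = - 1%:M + eta p *m xi p.
    apply: eq_mulmx_rV => v; have := h2 p v; rewrite /endo_app /one_form_app.
    rewrite mulmxA => ->; rewrite mulmxDr mulmxN mulmx1; congr (_ + _).
    rewrite mulmxA -mul_scalar_mx; congr (_ *m _).
    exact: (esym (mx11_scalar _)).
  have isom p : theta p *m g p *m (theta p)^T = g p - eta p *m (eta p)^T.
    apply: bilin_ext => u v; have := h3 p u v; rewrite /bilin_app /endo_app.
    rewrite trmx_mul !mulmxA => ->; rewrite mulmxBr mulmxBl [RHS]mxE; congr (_ + _).
    have -> : u *m (eta p *m (eta p)^T) *m v^T = u *m eta p *m (v *m eta p)^T.
      by rewrite trmx_mul !mulmxA.
    rewrite [RHS]mxE; congr (- _); rewrite [RHS]mxE big_ord1; congr (_ * _).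
    by rewrite [RHS]mxE.
  have th3 p := contact_theta3 (h1 p) (t2 p).
  have sk : skew_symmetric g theta.
    move=> p u v; rewrite /bilin_app /endo_app trmx_mul -!mulmxA.
    rewrite (mulmxA (theta p)) (contact_skew (h1 p) (t2 p) (isom p)).
    by rewrite mulNmx mulmxN mxE !mulmxA.
  exists g; split => //.
  have aD := levi_civita_connection rg; have sD := levi_civita_self_dual rg.
  exists (adapted theta (levi_civita g)), theta; split; [split|split].
  - exact: adapted_connection st th3 aD.
  - exact: adapted_self_dual rg st sk th3 sD.
  - by split=> //; split=> // p; exact: contact_rank (h1 p) (t2 p).
  - exact: adapted_parallel st th3 aD.
move=> [g [rg [_ [theta [_ [[st [sk rk]] _]]]]]]; subst m.
have [t [x [e h]]] := contact_structure rg st sk rk Aa Ac Ad.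
by exists t, x, e, g.
Qed.

Theorem theorem3p2 (R : realType) (n : nat) (M : manifold R (2 * n + 1))
    (M_orientable : orientable M) :
  (exists (theta : M -> 'M[R]_(2 * n + 1)) (xi : M -> 'rV[R]_(2 * n + 1))
          (eta : M -> 'cV[R]_(2 * n + 1)) (g : M -> 'M[R]_(2 * n + 1)),
     almost_contact_metric theta xi eta g)
  <->
  (exists g : M -> 'M[R]_(2 * n + 1),
     riemannian_metric g /\
     exists (nabla : (M -> 'rV[R]_(2 * n + 1)) -> (M -> 'rV[R]_(2 * n + 1)) ->
                     (M -> 'rV[R]_(2 * n + 1)))
            (theta : M -> 'M[R]_(2 * n + 1)),
       (affine_connection nabla /\ self_dual g nabla) /\
       (smooth_endo theta /\ skew_symmetric g theta /\
        constant_rank theta (2 * n)) /\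
       parallel_endo nabla theta).
Proof.
by apply: (contact_iff (n := n)) => //; rewrite mul2n addnn.
Qed.
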